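(* Let $\mathbf{X}\in\mathbb{R}^{d\times n}$, $\mathbf{W}^\star\in\mathbb{R}^{m\times d}$ and $\mathbf{Y}=\mathbf{W}^\star\mathbf{X}$, and let $\mathbf{Y}=\sum_{k=1}^{r^\star}\sigma_k^\star\mathbf{u}_k^\star\mathbf{v}_k^{\star\top}$ be a singular value decomposition of $\mathbf{Y}$ with $r^\star=\operatorname{rank}(\mathbf{Y})$ and $\sigma_1^\star\ge\dots\ge\sigma_{r^\star}^\star>0$. For $1\le r'\le r^\star$ let $\mathbf{Y}^{(r')}:=\sum_{k=1}^{r'}\sigma_k^\star\mathbf{u}_k^\star\mathbf{v}_k^{\star\top}$. Let $1\le r\le r^\star$, let $\{(\mathbf{a}_k,\mathbf{b}_k)\}_{k=1}^r$ be the output of the Inexact Sequential Low-Rank procedure (described in the context) on $(\mathbf{X},\mathbf{Y})$ with target rank $r$, and let $\bm{\delta}_k$ be the corresponding numerical errors, with $\|\bm{\delta}_k\|_F>0$ for $k=1,\dots,r$ and $\|\bm{\delta}_0\|_F:=0$. Define $\mathcal{T}_k^\star:=\min\{\min_{k<j\le r^\star}|\sigma_k^\star-\sigma_j^\star|,\ \sigma_k^\star\}$ and $$E(k):=\sigma_{\max}(\mathbf{X})\sum_{k'=0}^{k-1}\|\bm{\delta}_{k'}\|_F\prod_{j=k'+1}^{k-1}\Big(\frac{6\sigma_j^\star}{\mathcal{T}_j^\star}+2\Big).$$ If $E(k)<\tfrac12\min_{k<j\le r^\star}|\sigma_k^\star-\sigma_j^\star|$ for every $k\in\{1,\dots,r\}$,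 then for any $r'$ with $r\le r'\le r^\star$, $$\Big\|\mathbf{Y}^{(r')}-\sum_{k=1}^r\mathbf{b}_k\mathbf{a}_k^\top\mathbf{X}\Big\|_F\le\sum_{k=r+1}^{r'}\sigma_k^\star+\sigma_{\max}(\mathbf{X})\sum_{k=1}^{r}\sum_{k'=0}^{k}\|\bm{\delta}_{k'}\|_F\prod_{j=k'+1}^{k}\Big(2+\frac{6\sigma_j^\star}{\mathcal{T}_k^\star}\Big).$$
   Context: $\sigma_{\max}(\mathbf{X})$ is the largest singular value of $\mathbf{X}$. Inexact Sequential Low-Rank procedure: $\mathbf{Y}_1:=\mathbf{Y}$; for $k=1,\dots,r$, vectors $\mathbf{a}_k\in\mathbb{R}^d,\mathbf{b}_k\in\mathbb{R}^m$ are produced by an arbitrary approximate rank-1 solver applied to $(\mathbf{Y}_k,\mathbf{X})$, and $\mathbf{Y}_{k+1}:=\mathbf{Y}_k-\mathbf{b}_k\mathbf{a}_k^\top\mathbf{X}$. Numerical error: $(\overline{\mathbf{a}}_k,\overline{\mathbf{b}}_k)\in\arg\min_{\mathbf{a}\in\mathbb{R}^d,\mathbf{b}\in\mathbb{R}^m}\tfrac12\|\mathbf{Y}_k-\mathbf{b}\mathbf{a}^\top\mathbf{X}\|_F^2$ and $\bm{\delta}_k:=\mathbf{b}_k\mathbf{a}_k^\top-\overline{\mathbf{b}}_k\overline{\mathbf{a}}_k^\top$. *)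

(* Defs.v *)
From HB Require Import structures.
From mathcomp Require Import all_boot all_order all_algebra.
From mathcomp Require Import classical_sets reals.
Set Implicit Arguments. Unset Strict Implicit. Unset Printing Implicit Defensive.
Import Order.TTheory GRing.Theory Num.Theory.
Local Open Scope ring_scope.
Local Open Scope classical_set_scope.

Section Defs.
Variable R : realType.

Definition frob (p q : nat) (A : 'M[R]_(p, q)) : R :=
  Num.sqrt (\sum_(i < p) \sum_(j < q) (A i j) ^+ 2).

Definition singular_value (p q : nat) (X : 'M[R]_(p, q)) (s : R) : Prop :=
  0 <= s /\ exists (u : 'cV[R]_p) (v : 'cV[R]_q),
    u^T *m u = 1%:M /\ v^T *m v = 1%:M /\ X *m v = s *: u /\ X^T *m u = s *: v.

Definition sigma_max (p q : nat) (X : 'M[R]_(p, q)) : R :=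
  sup [set s | singular_value X s].

(* Inexact sequential low-rank procedure: residuals.
   resid Y X a b j = Y_{j+1}, i.e. resid 0 = Y_1 = Y and
   Y_{k+1} = Y_k - b_k a_k^T X. *)
Fixpoint resid (m d n : nat) (Y : 'M[R]_(m, n)) (X : 'M[R]_(d, n))
    (a : nat -> 'cV[R]_d) (b : nat -> 'cV[R]_m) (j : nat) : 'M[R]_(m, n) :=
  match j with
  | 0 => Y
  | j'.+1 => resid Y X a b j' - b j *m (a j)^T *m X
  end.

Definition is_rank1_argmin (m d n : nat) (Yk : 'M[R]_(m, n)) (X : 'M[R]_(d, n))
    (a : 'cV[R]_d) (b : 'cV[R]_m) : Prop :=
  forall (a' : 'cV[R]_d) (b' : 'cV[R]_m),
    (frob (Yk - b *m a^T *m X)) ^+ 2 / 2 <= (frob (Yk - b' *m a'^T *m X)) ^+ 2 / 2.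

Definition Tstar (sigma : nat -> R) (rstar k : nat) : R :=
  \big[Num.min/sigma k]_(k.+1 <= j < rstar.+1) `|sigma k - sigma j|.

End Defs.

(* Main.v *)
Require Import Defs.
From HB Require Import structures.
From mathcomp Require Import all_boot all_order all_algebra.
From mathcomp Require Import classical_sets reals.
From mathcomp Require Import ring lra zify.
Import Order.TTheory GRing.Theory Num.Theory.
Local Open Scope ring_scope.

Set Implicit Arguments. Unset Strict Implicit. Unset Printing Implicit Defensive.

(**
The constants in the conclusion involve only the gap T_k at the rank k of the last
step, so iterating a one-step bound, which would bring in every intermediate gap,
is not enough. Let tail_j M be M minus its best rank j approximation, and eps_k the
size sigma_max(X) |delta_k|_F of the k-th perturbation, so that Y_{k+1} is within
eps_k of tail_1(Y_k). One telescopes the sequence tail_{r-k+1}(Y_k), which goes from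
tail_r(Y) to Y_{r+1}. Its k-th increment compares tail_{r-k} at two matrices at
distance eps_k. By Weyl's inequality the singular values of Y_k stay within
eps_1 + ... + eps_{k-1} of those of Y, so the relevant gap is always comparable to
sigma_r - sigma_{r+1}, and truncation is Lipschitz with constant 2 sigma_r over this
gap. When r is the rank of Y no gap is available at r, but then the last exact step
is an optimal rank one approximation, and it is compared with the last singular
component of Y.
*)

(** * The Frobenius inner product and its norm *)

Section FrobeniusInnerProduct.
Variable R : realType.

(** The trace form lets a factor cross the product by transposition ([fdot_mull], [fdot_mulr]); on
    column vectors it is the Euclidean inner product. *)
Definition fdot p q (A B : 'M[R]_(p, q)) : R := \tr (A^T *m B).

Lemma fdotE p q (A B : 'M[R]_(p, q)) :
  fdot A B = \sum_(i < p) \sum_(j < q) A i j * B i j.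
Proof.
rewrite /fdot /mxtrace exchange_big; apply: eq_bigr => j _.
by rewrite mxE; apply: eq_bigr => i _; rewrite mxE.
Qed.

Lemma fdotC p q (A B : 'M[R]_(p, q)) : fdot A B = fdot B A.
Proof. by rewrite /fdot -mxtrace_tr trmx_mul trmxK. Qed.

Lemma fdotDr p q (A B C : 'M[R]_(p, q)) : fdot A (B + C) = fdot A B + fdot A C.
Proof. by rewrite /fdot mulmxDr mxtraceD. Qed.

Lemma fdotZr p q c (A B : 'M[R]_(p, q)) : fdot A (c *: B) = c * fdot A B.
Proof. by rewrite /fdot -scalemxAr mxtraceZ. Qed.

Lemma fdotNr p q (A B : 'M[R]_(p, q)) : fdot A (- B) = - fdot A B.
Proof. by rewrite -scaleN1r fdotZr mulN1r. Qed.

Lemma fdot0r p q (A : 'M[R]_(p, q)) : fdot A 0 = 0.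
Proof. by rewrite -(scale0r 0) fdotZr mul0r. Qed.

Lemma fdotDl p q (A B C : 'M[R]_(p, q)) : fdot (B + C) A = fdot B A + fdot C A.
Proof. by rewrite !(fdotC _ A) fdotDr. Qed.

Lemma fdotZl p q c (A B : 'M[R]_(p, q)) : fdot (c *: B) A = c * fdot B A.
Proof. by rewrite !(fdotC _ A) fdotZr. Qed.

Lemma fdotNl p q (A B : 'M[R]_(p, q)) : fdot (- B) A = - fdot B A.
Proof. by rewrite !(fdotC _ A) fdotNr. Qed.

Lemma fdot0l p q (A : 'M[R]_(p, q)) : fdot 0 A = 0.
Proof. by rewrite fdotC fdot0r. Qed.

Definition fdotB := (fdotDl, fdotDr, fdotNl, fdotNr).

Lemma fdot_sumr p q (A : 'M[R]_(p, q)) (I : Type) (s : seq I) (P : pred I)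
    (F : I -> 'M[R]_(p, q)) :
  fdot A (\sum_(i <- s | P i) F i) = \sum_(i <- s | P i) fdot A (F i).
Proof. exact: (big_morph (fdot A) (@fdotDr _ _ A) (fdot0r A)). Qed.

Lemma fdot_suml p q (A : 'M[R]_(p, q)) (I : Type) (s : seq I) (P : pred I)
    (F : I -> 'M[R]_(p, q)) :
  fdot (\sum_(i <- s | P i) F i) A = \sum_(i <- s | P i) fdot (F i) A.
Proof. by rewrite fdotC fdot_sumr; apply: eq_bigr => i _; rewrite fdotC. Qed.

Lemma fdot_tr p q (A B : 'M[R]_(p, q)) : fdot A^T B^T = fdot A B.
Proof. by rewrite /fdot trmxK mxtrace_mulC -[LHS]/(fdot B A) fdotC. Qed.

Lemma fdot_mull p q k (B : 'M[R]_(p, k)) (C : 'M[R]_(k, q)) (A : 'M[R]_(p, q)) :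
  fdot (B *m C) A = fdot C (B^T *m A).
Proof. by rewrite /fdot trmx_mul mulmxA. Qed.

Lemma fdot_mulr p q k (B : 'M[R]_(p, k)) (C : 'M[R]_(k, q)) (A : 'M[R]_(p, q)) :
  fdot (B *m C) A = fdot B (A *m C^T).
Proof. by rewrite /fdot trmx_mul -mulmxA mxtrace_mulC -mulmxA. Qed.

Lemma fdot_ge0 p q (A : 'M[R]_(p, q)) : 0 <= fdot A A.
Proof.
rewrite fdotE; apply: sumr_ge0 => i _; apply: sumr_ge0 => j _.
by rewrite -expr2 sqr_ge0.
Qed.

Lemma fdot_eq0 p q (A : 'M[R]_(p, q)) : fdot A A = 0 -> A = 0.
Proof.
rewrite fdotE => /eqP; rewrite psumr_eq0 => [/allP A0|i _]; last first.
  by apply: sumr_ge0 => j _; rewrite -expr2 sqr_ge0.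
apply/matrixP => i j; rewrite mxE.
move: (A0 i (mem_index_enum _)); rewrite /= psumr_eq0 => [/allP Ai0|k _]; last first.
  by rewrite -expr2 sqr_ge0.
by move: (Ai0 j (mem_index_enum _)); rewrite /= mulf_eq0 orbb => /eqP.
Qed.

Lemma fdot_gt0 p q (A : 'M[R]_(p, q)) : A != 0 -> 0 < fdot A A.
Proof.
by move=> An0; rewrite lt_neqAle fdot_ge0 andbT eq_sym; apply: contraNneq An0 => /fdot_eq0 ->.
Qed.

Lemma sqr_frob p q (A : 'M[R]_(p, q)) : frob A ^+ 2 = fdot A A.
Proof.
rewrite /frob sqr_sqrtr ?fdotE //; apply: sumr_ge0 => i _; apply: sumr_ge0 => j _.
exact: sqr_ge0.
Qed.

Lemma frob_ge0 p q (A : 'M[R]_(p, q)) : 0 <= frob A.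
Proof. exact: sqrtr_ge0. Qed.

Lemma frob_eq0 p q (A : 'M[R]_(p, q)) : frob A = 0 -> A = 0.
Proof. by move=> A0; apply: fdot_eq0; rewrite -sqr_frob A0 expr0n. Qed.

Lemma frob_le p q p' q' (A : 'M[R]_(p, q)) (B : 'M[R]_(p', q')) :
  fdot A A <= fdot B B -> frob A <= frob B.
Proof. by rewrite -!sqr_frob ler_sqr // nnegrE frob_ge0. Qed.

Lemma frob0 p q : frob (0 : 'M[R]_(p, q)) = 0.
Proof. by apply/eqP; rewrite -sqrf_eq0 sqr_frob fdot0r. Qed.

Lemma frobN p q (A : 'M[R]_(p, q)) : frob (- A) = frob A.
Proof. by apply/le_anti; rewrite !frob_le // fdotNl fdotNr opprK. Qed.

Lemma frob_distC p q (A B : 'M[R]_(p, q)) : frob (A - B) = frob (B - A).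
Proof. by rewrite -frobN opprB. Qed.

(** Cauchy-Schwarz, from expanding the squared norm of [fdot A A *: B - fdot A B *: A]. *)
Lemma fdot_le_frob p q (A B : 'M[R]_(p, q)) : fdot A B <= frob A * frob B.
Proof.
have [->|An0] := eqVneq A 0; first by rewrite fdot0l frob0 mul0r.
have a_gt0 := fdot_gt0 An0.
have : 0 <= fdot (fdot A A *: B - fdot A B *: A) (fdot A A *: B - fdot A B *: A).
  exact: fdot_ge0.
rewrite !fdotB !fdotZl !fdotZr (fdotC B A) => h.
have {}h : 0 <= fdot A A * (fdot A A * fdot B B - fdot A B ^+ 2) by lra.
rewrite pmulr_rge0 // subr_ge0 -!sqr_frob -exprMn in h.
have := frob_ge0 A; have := frob_ge0 B => hB hA.
by rewrite (le_trans (ler_norm _)) // -ler_sqr ?nnegrE ?mulr_ge0 // real_normK ?num_real.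
Qed.

Lemma frob_triangle p q (A B : 'M[R]_(p, q)) : frob (A + B) <= frob A + frob B.
Proof.
have := frob_ge0 A; have := frob_ge0 B => hB hA.
rewrite -ler_sqr ?nnegrE ?frob_ge0 ?addr_ge0 // sqr_frob !fdotB -!sqr_frob.
have := fdot_le_frob A B; rewrite (fdotC B A); lra.
Qed.

Lemma frob_sum p q (I : Type) (s : seq I) (P : pred I) (F : I -> 'M[R]_(p, q)) :
  frob (\sum_(i <- s | P i) F i) <= \sum_(i <- s | P i) frob (F i).
Proof.
elim/big_rec2: _ => [|i y x _ le_xy]; first by rewrite frob0.
by rewrite (le_trans (frob_triangle _ _)) // lerD2l.
Qed.

Lemma frobZ p q c (A : 'M[R]_(p, q)) : 0 <= c -> frob (c *: A) = c * frob A.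
Proof.
move=> c0; apply/eqP; rewrite -(@eqrXn2 _ 2) ?frob_ge0 ?mulr_ge0 ?frob_ge0 //.
by rewrite exprMn !sqr_frob fdotZl fdotZr mulrA.
Qed.

Lemma fdot_outer p q (x : 'cV[R]_p) (y : 'cV[R]_q) A :
  fdot (x *m y^T) A = fdot x (A *m y).
Proof. by rewrite fdot_mulr trmxK. Qed.

Lemma fdot_mulmx p q (x : 'cV[R]_p) (y : 'cV[R]_q) (A : 'M[R]_(p, q)) :
  fdot x (A *m y) = fdot (A^T *m x) y.
Proof. by rewrite fdot_mull trmxK. Qed.

Lemma scalar_dot p (x y : 'cV[R]_p) : x^T *m y = (fdot x y)%:M.
Proof. by rewrite [LHS]mx11_scalar /fdot /mxtrace big_ord1. Qed.

Lemma outer_mul p q (x : 'cV[R]_p) (y z : 'cV[R]_q) :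
  x *m y^T *m z = fdot y z *: x.
Proof. by rewrite -mulmxA scalar_dot mul_mx_scalar. Qed.

Lemma fdot_outer2 p q (x x' : 'cV[R]_p) (y y' : 'cV[R]_q) :
  fdot (x *m y^T) (x' *m y'^T) = fdot x x' * fdot y y'.
Proof. by rewrite fdot_outer outer_mul fdotZr mulrC (fdotC y'). Qed.

(** The square of [frob (A *m y)] is the inner product of [A] with the outer product of [A *m y] and
    [y]; Cauchy-Schwarz applies and one factor cancels. *)
Lemma frob_mul p q (A : 'M[R]_(p, q)) (y : 'cV[R]_q) : frob (A *m y) <= frob A * frob y.
Proof.
have [y0|] := eqVneq (A *m y) 0.
  by rewrite y0 frob0 mulr_ge0 ?frob_ge0.
move=> /fdot_gt0; rewrite -sqr_frob exprn_even_gt0 //= => n0.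
have {}n0 : 0 < frob (A *m y) by rewrite lt_neqAle eq_sym n0 frob_ge0.
rewrite -(ler_pM2l n0) -expr2 sqr_frob -{1}fdot_outer.
apply: le_trans (fdot_le_frob _ _) _.
suff -> : frob ((A *m y) *m y^T) = frob (A *m y) * frob y by rewrite -mulrA (mulrC (frob y)).
apply/eqP; rewrite -(@eqrXn2 _ 2) ?frob_ge0 ?mulr_ge0 ?frob_ge0 //.
by rewrite exprMn !sqr_frob fdot_outer2.
Qed.

Lemma frob_gt0 m n (A : 'M[R]_(m, n)) : A != 0 -> 0 < frob A.
Proof.
move=> An0; rewrite lt_neqAle frob_ge0 andbT eq_sym.
by apply: contraNneq An0 => /frob_eq0 ->.
Qed.

Lemma frob_unit m n (A : 'M[R]_(m, n)) : fdot A A = 1 -> frob A = 1.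
Proof.
by move=> A1; apply/eqP; rewrite -(@eqrXn2 _ 2) ?frob_ge0 // sqr_frob A1 expr1n.
Qed.

Lemma frob_dist_triangle p q (N M P : 'M[R]_(p, q)) :
  frob (M - P) <= frob (M - N) + frob (N - P).
Proof. by apply: le_trans (frob_triangle _ _); rewrite addrA subrK. Qed.

End FrobeniusInnerProduct.

(** * Operator bounds and existence of a largest singular pair *)

Section TopSingularPair.
Variable R : realType.

Definition op_bound m n (A : 'M[R]_(m, n)) (t : R) : Prop :=
  forall y : 'cV[R]_n, frob (A *m y) <= t * frob y.

Lemma fdot_op m n (A : 'M[R]_(m, n)) t : op_bound A t ->
  forall (x : 'cV[R]_m) (y : 'cV[R]_n), fdot x (A *m y) <= t * (frob x * frob y).
Proof.
move=> At x y; apply: le_trans (fdot_le_frob _ _) _.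
by rewrite mulrCA ler_wpM2l ?frob_ge0.
Qed.

Lemma op_bound_tr m n (A : 'M[R]_(m, n)) t : 0 <= t -> op_bound A t -> op_bound A^T t.
Proof.
move=> t0 At x; have [->|/frob_gt0 n0] := eqVneq (A^T *m x) 0.
  by rewrite frob0 mulr_ge0 ?frob_ge0.
rewrite -(ler_pM2r n0) -expr2 sqr_frob -fdot_mulmx.
by rewrite (le_trans (fdot_op At _ _)) // mulrA.
Qed.

(** The field [top_op] makes [s] the operator norm of [A], hence its largest singular value. *)
Record top_pair m n (A : 'M[R]_(m, n)) (s : R) (p : 'cV[R]_m) (q : 'cV[R]_n) : Prop :=
  TopPair {
    top_gt0 : 0 < s;
    top_unitl : fdot p p = 1;
    top_unitr : fdot q q = 1;
    top_mul : A *m q = s *: p;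
    top_mul_tr : A^T *m p = s *: q;
    top_op : op_bound A s }.

Lemma mulmx_neq0 m n (A : 'M[R]_(m, n)) : A != 0 -> exists y : 'cV[R]_n, A *m y != 0.
Proof.
move=> An0; have [j Aj|A0] := pickP (fun j => col j A != 0).
  by exists (delta_mx j 0); rewrite -colE.
case/eqP: An0; apply/matrixP => i j.
by have /negbFE/eqP/colP/(_ i) := A0 j; rewrite !mxE.
Qed.

Lemma normalized m (x : 'cV[R]_m) : x != 0 ->
  fdot ((frob x)^-1 *: x) ((frob x)^-1 *: x) = 1.
Proof.
move=> /frob_gt0 x0; rewrite fdotZl fdotZr -sqr_frob.
by field; rewrite gt_eqF.
Qed.

(* With T the supremum of |Ay|^2 over the unit ball, M = T - A^T A is positive
   semidefinite, and were it invertible the supremum could be lowered. Hence M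
   is singular, and any vector in its kernel is a top right singular vector. *)
Lemma top_pair_exists m n (A : 'M[R]_(m, n)) : A != 0 ->
  exists s p q, top_pair A s p q.
Proof.
move=> An0; have [y0 Ay0] := mulmx_neq0 An0.
pose S := [set fdot (A *m y) (A *m y) | y in [set y : 'cV[R]_n | fdot y y <= 1]]%classic.
have S0 : (S !=set0)%classic by exists 0; exists 0; rewrite /= ?mulmx0 fdot0l.
have supS : has_ubound S.
  exists (frob A ^+ 2) => _ [y y1 <-]; rewrite -sqr_frob ler_sqr ?nnegrE ?frob_ge0 //.
  apply: le_trans (frob_mul _ _) _; rewrite ler_piMr ?frob_ge0 //.
  by rewrite -(@ler_sqr _ _ 1) ?nnegrE ?frob_ge0 ?expr1n ?sqr_frob.
pose T := sup S.
have AT (y : 'cV[R]_n) : fdot (A *m y) (A *m y) <= T * fdot y y.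
  have [->|yn0] := eqVneq y 0; first by rewrite mulmx0 !fdot0l mulr0.
  have y_gt0 := frob_gt0 yn0.
  have : fdot (A *m ((frob y)^-1 *: y)) (A *m ((frob y)^-1 *: y)) <= T.
    by apply: ub_le_sup => //; exists ((frob y)^-1 *: y); rewrite //= normalized.
  rewrite -scalemxAr fdotZl fdotZr mulrA -expr2 exprVn sqr_frob mulrC.
  by rewrite ler_pdivrMr ?fdot_gt0.
have T_gt0 : 0 < T.
  have yn0 : y0 != 0 by apply: contraNneq Ay0 => ->; rewrite mulmx0.
  rewrite -(pmulr_lgt0 _ (fdot_gt0 yn0)).
  exact: lt_le_trans (fdot_gt0 Ay0) (AT _).
pose M : 'M[R]_n := T%:M - A^T *m A.
have M_tr : M^T = M by rewrite /M linearB /= tr_scalar_mx trmx_mul trmxK.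
have ME (y : 'cV[R]_n) : M *m y = T *: y - A^T *m (A *m y).
  by rewrite /M mulmxBl mul_scalar_mx mulmxA.
have formE (y : 'cV[R]_n) : fdot y (M *m y) = T * fdot y y - fdot (A *m y) (A *m y).
  by rewrite ME !fdotB fdotZr fdot_mulmx trmxK.
(* Expand the nonnegative form of [M] at [y - T^-1 *: (M *m y)] and discard the term in
   [A *m (M *m y)]. *)
have M_psd (y : 'cV[R]_n) : T^-1 * fdot (M *m y) (M *m y) <= fdot y (M *m y).
  have : 0 <= fdot (y - T^-1 *: (M *m y)) (M *m (y - T^-1 *: (M *m y))).
    by rewrite formE subr_ge0.
  rewrite mulmxBr -scalemxAr !fdotB !fdotZl !fdotZr (fdot_mulmx y (M *m y)) M_tr.
  rewrite [fdot (M *m y) (M *m (M *m y))]formE => h.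
  have h1 := fdot_ge0 (A *m (M *m y)).
  have h2 : T^-1 * (T^-1 * (T * fdot (M *m y) (M *m y))) = T^-1 * fdot (M *m y) (M *m y).
    by rewrite (mulrA _ T) mulVf ?mul1r // gt_eqF.
  have : 0 <= T^-1 * (T^-1 * fdot (A *m (M *m y)) (A *m (M *m y))).
    by rewrite !mulr_ge0 // invr_ge0 ltW.
  lra.
have Msing : M \notin unitmx.
  apply/negP => Mu.
  (* Invertibility gives [frob y <= k * frob (M *m y)], so [M_psd] bounds the form of [M] below by
     [c] times the squared norm of [y]; the summand 1 keeps [k] positive. *)
  pose k := frob (invmx M) + 1.
  have k_gt0 : 0 < k by rewrite ltr_wpDl ?frob_ge0.
  pose c := (k ^+ 2 * T)^-1.
  have c_gt0 : 0 < c by rewrite invr_gt0 mulr_gt0 ?exprn_gt0.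
  have Mc (y : 'cV[R]_n) : c * fdot y y <= fdot y (M *m y).
    apply: le_trans (M_psd y).
    rewrite /c invfM mulrAC mulrC ler_wpM2l ?invr_ge0 ?(ltW T_gt0) //.
    rewrite mulrC ler_pdivrMr ?exprn_gt0 // -!sqr_frob -exprMn.
    rewrite ler_sqr ?nnegrE ?mulr_ge0 ?frob_ge0 ?(ltW k_gt0) //.
    rewrite -{1}(mulKmx Mu y) mulrC.
    apply: le_trans (frob_mul _ _) _.
    by rewrite ler_wpM2r ?frob_ge0 // lerDl.
  have Ac (y : 'cV[R]_n) : fdot (A *m y) (A *m y) <= (T - c) * fdot y y.
    have := Mc y; rewrite formE; lra.
  have Tc : 0 <= T - c.
    have yn0 : y0 != 0 by apply: contraNneq Ay0 => ->; rewrite mulmx0.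
    by rewrite -(pmulr_lge0 _ (fdot_gt0 yn0)) (le_trans (fdot_ge0 _) (Ac _)).
  have : T <= T - c.
    apply: ge_sup => // _ [y y1 <-]; apply: le_trans (Ac y) _.
    by rewrite ler_piMr.
  lra.
have [q0 Mq0 q0n0] : exists2 q0 : 'cV[R]_n, M *m q0 = 0 & q0 != 0.
  rewrite -row_free_unit -kermx_eq0 in Msing.
  have /rowV0Pn [w /sub_kermxP wM wn0] := Msing.
  exists w^T; last by rewrite -(inj_eq (@trmx_inj _ _ _)) trmxK trmx0.
  by rewrite -M_tr -trmx_mul wM trmx0.
pose q := (frob q0)^-1 *: q0.
have q1 : fdot q q = 1 by apply: normalized.
have AAq : A^T *m (A *m q) = T *: q.
  by apply/esym/eqP; rewrite -subr_eq0 -ME /q -scalemxAr Mq0 scaler0.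
pose s := Num.sqrt T.
have s_gt0 : 0 < s by rewrite sqrtr_gt0.
have s2 : s ^+ 2 = T by rewrite sqr_sqrtr ?ltW.
exists s, (s^-1 *: (A *m q)), q; split => //.
- rewrite fdotZl fdotZr fdot_mulmx AAq fdotZl q1 -s2.
  by field; rewrite gt_eqF.
- by rewrite scalerA divff ?scale1r // gt_eqF.
- by rewrite -scalemxAr AAq -s2 scalerA expr2 mulKf // gt_eqF.
- move=> y; rewrite -ler_sqr ?nnegrE ?mulr_ge0 ?frob_ge0 ?(ltW s_gt0) //.
  by rewrite exprMn !sqr_frob s2.
Qed.

End TopSingularPair.

(** * Singular value decompositions and Weyl's inequality *)

Section SingularValueDecomposition.
Variable R : realType.

(** Families are indexed by all naturals, so that taking prefixes, shifting and prepending involve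
    no casts between ordinals. *)
Definition orthonormal_upto m (l : nat) (u : nat -> 'cV[R]_m) : Prop :=
  forall i j, (i < l)%N -> (j < l)%N -> fdot (u i) (u j) = (i == j)%:R.

(* The singular values are indexed from 0 and extended by 0 beyond the rank l. *)
Record svd m n (A : 'M[R]_(m, n)) (l : nat) (s : nat -> R)
    (u : nat -> 'cV[R]_m) (v : nat -> 'cV[R]_n) : Prop := Svd {
  svd_eq : A = \sum_(i < l) s i *: (u i *m (v i)^T);
  svd_u : orthonormal_upto l u;
  svd_v : orthonormal_upto l v;
  svd_gt0 : forall i, (i < l)%N -> 0 < s i;
  svd_out : forall i, (l <= i)%N -> s i = 0;
  svd_le : forall i j, (i <= j)%N -> s j <= s i }.

Definition trunc m n (s : nat -> R) (u : nat -> 'cV[R]_m) (v : nat -> 'cV[R]_n) k :=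
  \sum_(i < k) s i *: (u i *m (v i)^T).

Lemma orthonormalS m k l (u : nat -> 'cV[R]_m) :
  (k <= l)%N -> orthonormal_upto l u -> orthonormal_upto k u.
Proof. by move=> kl ou i j ik jk; apply: ou; apply: leq_trans kl. Qed.

Lemma pythagoras p q l (F : nat -> 'M[R]_(p, q)) :
  (forall i j, (i < l)%N -> (j < l)%N -> i != j -> fdot (F i) (F j) = 0) ->
  fdot (\sum_(i < l) F i) (\sum_(i < l) F i) = \sum_(i < l) fdot (F i) (F i).
Proof.
move=> F0; rewrite fdot_suml; apply: eq_bigr => i _.
rewrite fdot_sumr (bigD1 i) //= big1 ?addr0 // => j ij.
by apply: F0; rewrite // eq_sym.
Qed.

(** The left vectors are arbitrary: later they are what a projection leaves of singular vectors. *)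
Lemma fdot_sum_outer m n l (c : nat -> R) (w : nat -> 'cV[R]_m) (v : nat -> 'cV[R]_n) :
  orthonormal_upto l v ->
  fdot (\sum_(i < l) c i *: (w i *m (v i)^T)) (\sum_(i < l) c i *: (w i *m (v i)^T))
  = \sum_(i < l) c i ^+ 2 * fdot (w i) (w i).
Proof.
move=> ov; rewrite (@pythagoras _ _ l (fun i => c i *: (w i *m (v i)^T))) => [|i j il jl ij].
  by apply: eq_bigr => i _; rewrite fdotZl fdotZr fdot_outer2 ov // eqxx mulr1 mulrA.
by rewrite fdotZl fdotZr fdot_outer2 ov // (negbTE ij) !mulr0.
Qed.

Lemma fdot_sum_orthonormal m l (c : nat -> R) (u : nat -> 'cV[R]_m) :
  orthonormal_upto l u ->
  fdot (\sum_(i < l) c i *: u i) (\sum_(i < l) c i *: u i) = \sum_(i < l) c i ^+ 2.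
Proof.
move=> ou; rewrite (@pythagoras _ _ l (fun i => c i *: u i)) => [|i j il jl ij].
  by apply: eq_bigr => i _; rewrite fdotZl fdotZr ou // eqxx mulr1 expr2.
by rewrite fdotZl fdotZr ou // (negbTE ij) !mulr0.
Qed.

(** Expand the squared norm of [y - z], where [z] is the projection of [y] on the span of the
    family. *)
Lemma bessel m l (u : nat -> 'cV[R]_m) (y : 'cV[R]_m) :
  orthonormal_upto l u -> \sum_(i < l) fdot (u i) y ^+ 2 <= fdot y y.
Proof.
move=> ou; pose z := \sum_(i < l) fdot (u i) y *: u i.
have zz : fdot z z = \sum_(i < l) fdot (u i) y ^+ 2.
  exact: (fdot_sum_orthonormal (fun i => fdot (u i) y)).
have yz : fdot y z = \sum_(i < l) fdot (u i) y ^+ 2.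
  by rewrite fdot_sumr; apply: eq_bigr => i _; rewrite fdotZr fdotC expr2.
have := fdot_ge0 (y - z); rewrite !fdotB (fdotC z y) zz yz; lra.
Qed.

Lemma sum_outer_mul m n l (s : nat -> R) (u : nat -> 'cV[R]_m) (v : nat -> 'cV[R]_n) y :
  (\sum_(i < l) s i *: (u i *m (v i)^T)) *m y = \sum_(i < l) (s i * fdot (v i) y) *: u i.
Proof.
by rewrite mulmx_suml; apply: eq_bigr => i _; rewrite -scalemxAl outer_mul scalerA.
Qed.

Lemma svd_ge0 m n (A : 'M[R]_(m, n)) l s u v i : svd A l s u v -> 0 <= s i.
Proof.
move=> h; have [il|li] := ltnP i l; first exact/ltW/(svd_gt0 h).
by rewrite (svd_out h).
Qed.

Lemma svd_mul_norm m n (A : 'M[R]_(m, n)) l s u v (y : 'cV[R]_n) : svd A l s u v ->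
  fdot (A *m y) (A *m y) = \sum_(i < l) (s i * fdot (v i) y) ^+ 2.
Proof.
case=> {1 2}-> ou _ _ _ _; rewrite sum_outer_mul.
exact: (fdot_sum_orthonormal (fun i => s i * fdot (v i) y)).
Qed.

(** The coefficients of [y] below [k] vanish, the other singular values are at most [s k], and
    Bessel bounds what remains. *)
Lemma svd_mul_le m n (A : 'M[R]_(m, n)) l s u v k (y : 'cV[R]_n) : svd A l s u v ->
  (forall i, (i < k)%N -> fdot (v i) y = 0) -> frob (A *m y) <= s k * frob y.
Proof.
move=> h y0; have s0 := svd_ge0 k h.
rewrite -ler_sqr ?nnegrE ?mulr_ge0 ?frob_ge0 // exprMn !sqr_frob (svd_mul_norm _ h).
apply: le_trans (ler_wpM2l _ (bessel y (svd_v h))); last exact: sqr_ge0.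
rewrite mulr_sumr; apply: ler_sum => i _; rewrite exprMn.
have [/y0 ->|ki] := ltnP i k; first by rewrite expr0n /= !mulr0.
rewrite ler_wpM2r ?sqr_ge0 // ler_sqr ?nnegrE //; first exact: svd_le h _ _ ki.
exact: svd_ge0 h.
Qed.

Lemma svd_op m n (A : 'M[R]_(m, n)) l s u v : svd A l s u v -> op_bound A (s 0%N).
Proof. by move=> h y; apply: svd_mul_le h _. Qed.

Lemma svd_trunc_out m n (A : 'M[R]_(m, n)) l s u v k :
  svd A l s u v -> (l <= k)%N -> trunc s u v k = A.
Proof.
move=> h /subnKC <-; rewrite /trunc big_split_ord /= -(svd_eq h) big1 ?addr0 // => i _.
by rewrite (svd_out h) ?leq_addr // scale0r.
Qed.

(** For [k > l] the truncated subtraction [l - k] is 0, and this is the empty decomposition of the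
    zero matrix. *)
Lemma svd_drop m n (A : 'M[R]_(m, n)) l s u v k : svd A l s u v ->
  svd (A - trunc s u v k) (l - k) (fun i => s (k + i)%N)
      (fun i => u (k + i)%N) (fun i => v (k + i)%N).
Proof.
move=> h; split.
- have -> : A = trunc s u v (k + (l - k)) by rewrite (svd_trunc_out h) // -leq_subLR.
  by rewrite /trunc big_split_ord /= addrAC subrr add0r.
- by move=> i j il jl; rewrite (svd_u h) -?ltn_subRL // eqn_add2l.
- by move=> i j il jl; rewrite (svd_v h) -?ltn_subRL // eqn_add2l.
- by move=> i il; rewrite (svd_gt0 h) -?ltn_subRL.
- by move=> i il; rewrite (svd_out h) -?leq_subLR.
- by move=> i j ij; rewrite (svd_le h) // leq_add2l.
Qed.

Definition scons T (x : T) (f : nat -> T) (i : nat) : T := if i is j.+1 then f j else x.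

Lemma orthonormal_cons m l (p : 'cV[R]_m) u : fdot p p = 1 -> orthonormal_upto l u ->
  (forall i, (i < l)%N -> fdot p (u i) = 0) -> orthonormal_upto l.+1 (scons p u).
Proof.
move=> p1 ou pu [|i] [|j] //= il jl; first exact: pu.
  by rewrite fdotC pu.
by rewrite ou.
Qed.

Lemma svd_left m n (A : 'M[R]_(m, n)) l s u v i : svd A l s u v -> (i < l)%N ->
  A *m v i = s i *: u i.
Proof.
move=> h il; rewrite {1}(svd_eq h) sum_outer_mul (bigD1 (Ordinal il)) //=.
rewrite (svd_v h) // eqxx mulr1 big1 ?addr0 // => j ji.
by rewrite (svd_v h) // (_ : _ == _ = false) ?mulr0 ?scale0r //; apply: negbTE.
Qed.

Lemma svd_tr m n (A : 'M[R]_(m, n)) l s u v : svd A l s u v -> svd A^T l s v u.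
Proof.
move=> h; split; try by [case: h].
rewrite {1}(svd_eq h) raddf_sum; apply: eq_bigr => i _ /=.
by rewrite linearZ /= trmx_mul trmxK.
Qed.

(** The deflated matrix kills [q] and its transpose kills [p], which makes them orthogonal to its
    singular vectors. Its largest value is a value of the bilinear form of [A] at unit vectors,
    hence at most [s0]. *)
Lemma svd_cons m n (A : 'M[R]_(m, n)) s0 p q l s u v :
  top_pair A s0 p q -> svd (A - s0 *: (p *m q^T)) l s u v ->
  svd A l.+1 (scons s0 s) (scons p u) (scons q v).
Proof.
case=> s0_gt0 p1 q1 Aq Ap Aop h; set A' := A - _ in h.
have A'q : A' *m q = 0 by rewrite mulmxBl Aq -scalemxAl outer_mul q1 scale1r subrr.
have A'p : A'^T *m p = 0.
  by rewrite linearB /= mulmxBl Ap linearZ /= -scalemxAl trmx_mul trmxK outer_mul p1 scale1r subrr.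
have pu i : (i < l)%N -> fdot p (u i) = 0.
  move=> il; have /gt_eqF sn0 := svd_gt0 h il.
  apply/eqP; rewrite -[_ == 0]orFb -sn0 -mulf_eq0.
  by rewrite -fdotZr -(svd_left h) // fdot_mulmx A'p fdot0l.
have qv i : (i < l)%N -> fdot q (v i) = 0.
  move=> il; have /gt_eqF sn0 := svd_gt0 h il.
  apply/eqP; rewrite -[_ == 0]orFb -sn0 -mulf_eq0.
  by rewrite -fdotZr -(svd_left (svd_tr h)) // fdot_mulmx trmxK A'q fdot0l.
have le0 : s 0%N <= s0.
  have [l0|] := posnP l; first by rewrite (svd_out h) ?l0 // ltW.
  move=> l0; have u1 := svd_u h l0 l0; have v1 := svd_v h l0 l0.
  rewrite eqxx /= in u1 v1.
  have -> : s 0%N = fdot (u 0%N) (A *m v 0%N).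
    have -> : A = A' + s0 *: (p *m q^T) by rewrite subrK.
    rewrite mulmxDl (svd_left h) // -scalemxAl outer_mul qv // scale0r scaler0 addr0.
    by rewrite fdotZr u1 mulr1.
  by apply: le_trans (fdot_op Aop _ _) _; rewrite !frob_unit // !mulr1.
split.
- by rewrite big_ord_recl /= -(svd_eq h) addrC subrK.
- exact: orthonormal_cons (svd_u h) pu.
- exact: orthonormal_cons (svd_v h) qv.
- by move=> [|i] //= il; apply: (svd_gt0 h).
- by move=> [|i] //= il; apply: (svd_out h).
- move=> [|i] [|j] //= ij; last exact: (svd_le h).
  exact: le_trans (svd_le h (leq0n j)) le0.
Qed.

Lemma svd0 m n : svd (0 : 'M[R]_(m, n)) 0 (fun=> 0) (fun=> 0) (fun=> 0).
Proof. by split => //; rewrite big_ord0. Qed.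

(** Induction on the rank, splitting off a top pair each time. *)
Lemma svd_exists m n (A : 'M[R]_(m, n)) : exists l s u v, svd A l s u v.
Proof.
have [k] := ubnP (\rank A); elim: k A => // k IH A rk.
have [->|An0] := eqVneq A 0; first by do 4!eexists; exact: svd0.
have [s0 [p [q h]]] := top_pair_exists An0.
pose A' := A - s0 *: (p *m q^T).
have [s0_gt0 p1 q1 Aq Ap _] := h.
have qA : q^T = (s0^-1 *: p^T) *m A.
  rewrite -scalemxAl -[p^T *m A]trmxK trmx_mul trmxK Ap linearZ /= scalerA mulVf ?scale1r //.
  by rewrite gt_eqF.
have A'q : A' *m q = 0 by rewrite mulmxBl Aq -scalemxAl outer_mul q1 scale1r subrr.
(* The row space shrinks strictly: [q^T] lies in that of [A], but were it in that of [A'], then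
   [A' *m q = 0] would force [q^T *m q = 0]. *)
have /IH [l [s [u [v h']]]] : (\rank A' < k)%N.
  rewrite ltnS in rk; apply: leq_trans rk; apply: rank_ltmx.
  rewrite ltmxE; apply/andP; split.
    by rewrite addmx_sub ?submx_refl // eqmx_opp scalemx_sub // qA mulmxA submxMl.
  apply/negP => AA'; have : (q^T <= A')%MS by rewrite qA (submx_trans (submxMl _ _)).
  move=> /submxP [w qw].
  have : q^T *m q = 0 by rewrite qw -mulmxA A'q mulmx0.
  rewrite scalar_dot q1 => /matrixP /(_ 0 0); rewrite !mxE /= => /eqP.
  by rewrite oner_eq0.
by exists l.+1, (scons s0 s), (scons p u), (scons q v); apply: svd_cons h h'.
Qed.

(* A combination of the first i+1 right singular vectors of B can be chosen
   orthogonal to the first i right singular vectors of A. *)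
Lemma weyl m n (A B : 'M[R]_(m, n)) lA sA uA vA lB sB uB vB e i :
  svd A lA sA uA vA -> svd B lB sB uB vB -> frob (A - B) <= e -> sB i <= sA i + e.
Proof.
move=> hA hB le_e; have e0 : 0 <= e := le_trans (frob_ge0 _) le_e.
have [il|li] := ltnP i lB; last first.
  by rewrite (svd_out hB) // addr_ge0 // (svd_ge0 _ hA).
(* [M] has one more row than columns, so its left kernel contains a nonzero [c], the coefficient
   vector of the combination. *)
pose M := \matrix_(j < i.+1, k < i) fdot (vB j) (vA k).
have /rowV0Pn [c /sub_kermxP cM cn0] : kermx M != 0.
  rewrite -mxrank_eq0 mxrank_ker subn_eq0 -ltnNge ltnS; exact: rank_leq_col.
pose y := \sum_(j < i.+1) c 0 (inord j) *: vB j.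
have oB : orthonormal_upto i.+1 vB := orthonormalS il (svd_v hB).
have yy : fdot y y = \sum_(j < i.+1) c 0 j ^+ 2.
  rewrite (fdot_sum_orthonormal (fun j => c 0 (inord j)) oB).
  by apply: eq_bigr => j _; rewrite inord_val.
have yn0 : 0 < frob y.
  have /fdot_gt0 : c != 0 := cn0.
  rewrite fdotE big_ord1; under eq_bigr do rewrite -expr2.
  by rewrite -yy -sqr_frob exprn_even_gt0 //= lt_neqAle frob_ge0 andbT eq_sym.
have yA k : (k < i)%N -> fdot (vA k) y = 0.
  move=> ki; have /matrixP /(_ 0 (Ordinal ki)) := cM; rewrite !mxE => <-.
  rewrite fdot_sumr; apply: eq_bigr => j _.
  by rewrite fdotZr inord_val mxE fdotC.
have Ay := svd_mul_le hA yA.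
(* [y] lies in the span of the first [i.+1] right singular vectors of [B], where [B] stretches by at
   least [sB i]. *)
have By : sB i * frob y <= frob (B *m y).
  rewrite -ler_sqr ?nnegrE ?mulr_ge0 ?frob_ge0 ?(svd_ge0 _ hB) // exprMn !sqr_frob.
  have -> : B *m y = \sum_(j < i.+1) (sB j * c 0 (inord j)) *: uB j.
    rewrite mulmx_sumr; apply: eq_bigr => j _.
    rewrite -scalemxAr (svd_left hB) ?scalerA 1?mulrC //; exact: leq_trans (ltn_ord j) il.
  rewrite (fdot_sum_orthonormal (fun j => sB j * c 0 (inord j)) (orthonormalS il (svd_u hB))).
  rewrite yy mulr_sumr; apply: ler_sum => j _; rewrite inord_val exprMn.
  rewrite ler_wpM2r ?sqr_ge0 // ler_sqr ?nnegrE ?(svd_ge0 _ hB) //.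
  by apply: (svd_le hB); rewrite -ltnS.
have : frob (B *m y) <= frob (A *m y) + e * frob y.
  have -> : B *m y = A *m y + (B - A) *m y by rewrite -mulmxDl addrC subrK.
  apply: le_trans (frob_triangle _ _) _; rewrite lerD2l.
  apply: le_trans (frob_mul _ _) _.
  by rewrite ler_wpM2r ?frob_ge0 // frob_distC.
move=> h; rewrite -(ler_pM2r yn0) mulrDl; lra.
Qed.

End SingularValueDecomposition.

(** * Lipschitz bounds for truncations and tails under a spectral gap *)

Section TruncationIsLipschitz.
Variable R : realType.

Definition orthoproj m (P : 'M[R]_m) : Prop := P^T = P /\ P *m P = P.

Lemma orthoproj_split m n (P : 'M[R]_m) (M : 'M[R]_(m, n)) : orthoproj P ->
  fdot M M = fdot (P *m M) (P *m M) + fdot (M - P *m M) (M - P *m M).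
Proof.
case=> Pt PP; rewrite !fdotB.
have -> : fdot (P *m M) (P *m M) = fdot (P *m M) M by rewrite fdot_mull Pt mulmxA PP fdotC.
rewrite (fdotC M); lra.
Qed.

Lemma orthoproj_sub_le m n (Q : 'M[R]_n) (M : 'M[R]_(m, n)) : orthoproj Q ->
  fdot (M - M *m Q) (M - M *m Q) <= fdot M M.
Proof.
move=> oQ; have [Qt _] := oQ.
rewrite -(fdot_tr M) (orthoproj_split M^T oQ) -fdot_tr linearB /= trmx_mul Qt.
by rewrite lerDr fdot_ge0.
Qed.

(** Both residues are orthogonal pieces of [A1 - B1]: the first is its part outside [P], the second,
    up to sign, its part inside [P] and outside [Q]. *)
Lemma proj_residues_le m n (A1 B1 : 'M[R]_(m, n)) (P : 'M[R]_m) (Q : 'M[R]_n) :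
  orthoproj P -> orthoproj Q -> P *m B1 = B1 -> A1 *m Q = A1 ->
  fdot (A1 - P *m A1) (A1 - P *m A1) + fdot (B1 - B1 *m Q) (B1 - B1 *m Q)
  <= fdot (A1 - B1) (A1 - B1).
Proof.
move=> oP oQ PB AQ; rewrite (orthoproj_split (A1 - B1) oP) addrC lerD //.
  have -> : B1 - B1 *m Q = - (P *m (A1 - B1) - P *m (A1 - B1) *m Q).
    rewrite mulmxBr PB mulmxBl -mulmxA AQ.
    move: (P *m A1) (B1 *m Q) => M N.
    by apply/matrixP => i j; rewrite !mxE; ring.
  by rewrite fdotNl fdotNr opprK orthoproj_sub_le.
rewrite mulmxBr PB (_ : A1 - B1 - _ = A1 - P *m A1) //.
move: (P *m A1) => M; by apply/matrixP => i j; rewrite !mxE; ring.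
Qed.

(* Expanding <A1 - B1, A - B> leaves |A1 - B1|^2 minus the two cross terms, which
   the hypotheses bound by a fraction th of |A1 - B1|^2. *)
Lemma split_lipschitz m n (A1 A2 B1 B2 : 'M[R]_(m, n)) (P P' : 'M[R]_m) (Q Q' : 'M[R]_n) th :
  orthoproj P -> orthoproj Q -> orthoproj P' -> orthoproj Q' ->
  P *m A1 = A1 -> A1 *m Q = A1 -> P *m A2 = 0 ->
  P' *m B1 = B1 -> B1 *m Q' = B1 -> P' *m B2 = 0 -> 0 <= th ->
  fdot A1 B2 <= th / 2 * (fdot (A1 - P' *m A1) (A1 - P' *m A1)
                          + fdot (A1 - A1 *m Q') (A1 - A1 *m Q')) ->
  fdot B1 A2 <= th / 2 * (fdot (B1 - P *m B1) (B1 - P *m B1)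
                          + fdot (B1 - B1 *m Q) (B1 - B1 *m Q)) ->
  (1 - th) * frob (A1 - B1) <= frob (A1 + A2 - (B1 + B2)).
Proof.
move=> oP oQ oP' oQ' PA1 A1Q PA2 PB1 B1Q PB2 th0 cA cB.
(* The four residues in the cross-term hypotheses pair up as [P'] with [Q] and [P] with [Q']; each
   pair costs one squared norm of [A1 - B1], which explains the factor [th / 2]. *)
have n1 := proj_residues_le oP' oQ PB1 A1Q.
have n2 := proj_residues_le oP oQ' PA1 B1Q.
have A12 : fdot A1 A2 = 0 by rewrite -PA1 fdot_mull oP.1 PA2 fdot0r.
have B12 : fdot B1 B2 = 0 by rewrite -PB1 fdot_mull oP'.1 PB2 fdot0r.
have DD : fdot (B1 - A1) (B1 - A1) = fdot (A1 - B1) (A1 - B1).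
  by rewrite -opprB fdotNl fdotNr opprK.
have [->|/frob_gt0 D_gt0] := eqVneq (A1 - B1) 0; first by rewrite frob0 mulr0 frob_ge0.
rewrite -(ler_pM2r D_gt0) -mulrA -expr2 sqr_frob mulrC [X in _ <= X]mulrC.
apply: le_trans (fdot_le_frob _ _).
have -> : fdot (A1 - B1) (A1 + A2 - (B1 + B2))
          = fdot (A1 - B1) (A1 - B1) - fdot A1 B2 - fdot B1 A2.
  by rewrite !fdotB A12 B12 (fdotC B1 A1); ring.
have : th / 2 * (fdot (A1 - P' *m A1) (A1 - P' *m A1) + fdot (B1 - B1 *m Q) (B1 - B1 *m Q))
       <= th / 2 * fdot (A1 - B1) (A1 - B1) by rewrite ler_wpM2l // divr_ge0.
have : th / 2 * (fdot (B1 - P *m B1) (B1 - P *m B1) + fdot (A1 - A1 *m Q') (A1 - A1 *m Q'))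
       <= th / 2 * fdot (A1 - B1) (A1 - B1) by rewrite ler_wpM2l ?divr_ge0 // -DD.
lra.
Qed.

Definition span_proj m (u : nat -> 'cV[R]_m) k := \sum_(i < k) u i *m (u i)^T.

Lemma span_proj_mul m (u : nat -> 'cV[R]_m) k y :
  span_proj u k *m y = \sum_(i < k) fdot (u i) y *: u i.
Proof. by rewrite mulmx_suml; apply: eq_bigr => i _; rewrite outer_mul. Qed.

Lemma span_proj_in m (u : nat -> 'cV[R]_m) k i : orthonormal_upto k u -> (i < k)%N ->
  span_proj u k *m u i = u i.
Proof.
move=> ou ik; rewrite span_proj_mul (bigD1 (Ordinal ik)) //= ou // eqxx scale1r.
rewrite big1 ?addr0 // => j ji; rewrite ou // (_ : _ == _ = false) ?scale0r //.
exact: negbTE.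
Qed.

Lemma span_proj_out m (u : nat -> 'cV[R]_m) k l i : orthonormal_upto l u ->
  (k <= i < l)%N -> span_proj u k *m u i = 0.
Proof.
move=> ou /andP[ki il]; rewrite span_proj_mul big1 // => j _.
have ji : (j < i)%N := leq_trans (ltn_ord j) ki.
by rewrite ou ?(ltn_trans ji) // (ltn_eqF ji) scale0r.
Qed.

Lemma span_projP m (u : nat -> 'cV[R]_m) k : orthonormal_upto k u -> orthoproj (span_proj u k).
Proof.
move=> ou; split.
  by rewrite raddf_sum; apply: eq_bigr => i _ /=; rewrite trmx_mul trmxK.
by rewrite {2}/span_proj mulmx_sumr; apply: eq_bigr => i _; rewrite mulmxA span_proj_in.
Qed.

Section Parts.
Variables (m n : nat) (A : 'M[R]_(m, n)) (l : nat) (s : nat -> R).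
Variables (u : nat -> 'cV[R]_m) (v : nat -> 'cV[R]_n) (k : nat).
Hypotheses (hA : svd A l s u v) (kl : (k <= l)%N).

Lemma span_proj_trunc : span_proj u k *m trunc s u v k = trunc s u v k.
Proof.
rewrite /trunc mulmx_sumr; apply: eq_bigr => i _.
by rewrite -scalemxAr mulmxA span_proj_in //; apply: orthonormalS kl (svd_u hA).
Qed.

Lemma span_proj_tail : span_proj u k *m (A - trunc s u v k) = 0.
Proof.
rewrite (svd_eq (svd_drop k hA)) mulmx_sumr big1 // => i _.
rewrite -scalemxAr mulmxA (span_proj_out (svd_u hA)) ?mul0mx ?scaler0 //.
by rewrite leq_addr -ltn_subRL ltn_ord.
Qed.

Lemma tail_op : op_bound (A - trunc s u v k) (s k).
Proof. by have := svd_op (svd_drop k hA); rewrite addn0. Qed.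

End Parts.

Lemma trunc_tr m n s (u : nat -> 'cV[R]_m) (v : nat -> 'cV[R]_n) k :
  (trunc s u v k)^T = trunc s v u k.
Proof.
rewrite raddf_sum; apply: eq_bigr => i _ /=.
by rewrite linearZ /= trmx_mul trmxK.
Qed.

Section RightParts.
Variables (m n : nat) (A : 'M[R]_(m, n)) (l : nat) (s : nat -> R).
Variables (u : nat -> 'cV[R]_m) (v : nat -> 'cV[R]_n) (k : nat).
Hypotheses (hA : svd A l s u v) (kl : (k <= l)%N).

Lemma trunc_span_proj : trunc s u v k *m span_proj v k = trunc s u v k.
Proof.
have [Qt _] := span_projP (orthonormalS kl (svd_v hA)).
by rewrite -[LHS]trmxK trmx_mul Qt !trunc_tr (span_proj_trunc (svd_tr hA) kl) trunc_tr.
Qed.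

Lemma tail_span_proj : (A - trunc s u v k) *m span_proj v k = 0.
Proof.
have [Qt _] := span_projP (orthonormalS kl (svd_v hA)).
rewrite -[LHS]trmxK trmx_mul Qt linearB /= trunc_tr (span_proj_tail _ (svd_tr hA)).
exact: trmx0.
Qed.

End RightParts.

(** Since [P] and [Q] annihilate [B2], each singular component of [A1] meets [B2] only through the
    residues [x i] and [y i]. The operator bound and the inequality between arithmetic and geometric
    means then give the estimate term by term. *)
Lemma trunc_cross_le m n (A : 'M[R]_(m, n)) l s u v k (A1 B2 : 'M[R]_(m, n))
    (P : 'M[R]_m) (Q : 'M[R]_n) t th :
  svd A l s u v -> (k <= l)%N -> P^T = P -> P *m B2 = 0 -> B2 *m Q = 0 -> Q^T = Q ->
  op_bound B2 t -> 0 <= t -> (forall i, (i < k)%N -> t <= th * s i) ->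
  A1 = trunc s u v k ->
  fdot A1 B2 <= th / 2 * (fdot (A1 - P *m A1) (A1 - P *m A1)
                          + fdot (A1 - A1 *m Q) (A1 - A1 *m Q)).
Proof.
move=> hA kl Pt PB BQ Qt Bt t0 tth defA1.
pose x i := u i - P *m u i; pose y i := v i - Q *m v i.
have -> : fdot (A1 - P *m A1) (A1 - P *m A1) = \sum_(i < k) s i ^+ 2 * fdot (x i) (x i).
  rewrite -(fdot_sum_outer _ _ (orthonormalS kl (svd_v hA))).
  have -> // : A1 - P *m A1 = \sum_(i < k) s i *: (x i *m (v i)^T).
  rewrite defA1 mulmx_sumr -sumrB; apply: eq_bigr => i _.
  by rewrite -scalemxAr -scalerBr mulmxA -mulmxBl.
have -> : fdot (A1 - A1 *m Q) (A1 - A1 *m Q) = \sum_(i < k) s i ^+ 2 * fdot (y i) (y i).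
  rewrite -(fdot_sum_outer _ _ (orthonormalS kl (svd_u hA))) -fdot_tr.
  have -> // : (A1 - A1 *m Q)^T = \sum_(i < k) s i *: (y i *m (u i)^T).
  rewrite linearB /= trmx_mul Qt defA1 trunc_tr mulmx_sumr -sumrB; apply: eq_bigr => i _.
  by rewrite -scalemxAr -scalerBr mulmxA -mulmxBl.
rewrite defA1 -big_split mulr_sumr fdot_suml; apply: ler_sum => i _ /=.
have s_gt0 : 0 < s i by apply: (svd_gt0 hA); apply: leq_trans (ltn_ord i) kl.
have -> : fdot (s i *: (u i *m (v i)^T)) B2 = s i * fdot (x i) (B2 *m y i).
  rewrite fdotZl fdot_outer /y mulmxBr (mulmxA B2) BQ mul0mx subr0.
  by rewrite /x fdotDl fdotNl fdot_mull Pt (mulmxA P) PB mul0mx fdot0r subr0.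
rewrite -mulrDr mulrCA expr2 -mulrA ler_pM2l //.
apply: le_trans (fdot_op Bt _ _) _.
have -> : s i * (th / 2 * (fdot (x i) (x i) + fdot (y i) (y i)))
    = th * s i * ((fdot (x i) (x i) + fdot (y i) (y i)) / 2) by ring.
rewrite -!sqr_frob; apply: ler_pM => //; first by rewrite mulr_ge0 ?frob_ge0.
  exact: tth.
have := sqr_ge0 (frob (x i) - frob (y i)); rewrite sqrrB; lra.
Qed.

(** [split_lipschitz] for truncations and tails, with the projections on the leading left and right
    singular spaces of [A] and [B]. *)
Lemma trunc_lipschitz m n (A B : 'M[R]_(m, n)) lA sA uA vA lB sB uB vB k th :
  svd A lA sA uA vA -> svd B lB sB uB vB -> (k < lA)%N -> (k < lB)%N -> 0 <= th ->
  sB k.+1 <= th * sA k -> sA k.+1 <= th * sB k ->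
  (1 - th) * frob (trunc sA uA vA k.+1 - trunc sB uB vB k.+1) <= frob (A - B).
Proof.
move=> hA hB kA kB th0 BA AB.
have le_th s i : (forall i j, (i <= j)%N -> s j <= s i) -> (i < k.+1)%N -> th * s k <= th * s i.
  by move=> sle ik; apply: ler_wpM2l => //; apply: sle.
rewrite -(subrKC (trunc sA uA vA k.+1) A) -(subrKC (trunc sB uB vB k.+1) B).
have oPA := span_projP (orthonormalS kA (svd_u hA)).
have oQA := span_projP (orthonormalS kA (svd_v hA)).
have oPB := span_projP (orthonormalS kB (svd_u hB)).
have oQB := span_projP (orthonormalS kB (svd_v hB)).
apply: (split_lipschitz oPA oQA oPB oQB) => //.
- exact: span_proj_trunc hA kA.
- exact: trunc_span_proj hA kA.
- exact: span_proj_tail _ hA.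
- exact: span_proj_trunc hB kB.
- exact: trunc_span_proj hB kB.
- exact: span_proj_tail _ hB.
- apply: (trunc_cross_le hA kA oPB.1 _ _ oQB.1 (tail_op _ hB)).
  + exact: span_proj_tail _ hB.
  + exact: tail_span_proj hB kB.
  + exact: svd_ge0 hB.
  + by move=> i ik; apply: le_trans BA (le_th _ _ (svd_le hA) ik).
  + by [].
- apply: (trunc_cross_le hB kB oPA.1 _ _ oQA.1 (tail_op _ hA)).
  + exact: span_proj_tail _ hA.
  + exact: tail_span_proj hA kA.
  + exact: svd_ge0 hA.
  + by move=> i ik; apply: le_trans AB (le_th _ _ (svd_le hB) ik).
  + by [].
Qed.

(** In the application [x] and [y] are consecutive singular values of the unperturbed matrix, and
    [a], [b] bound how far those of [A] and [B] have drifted. *)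
Lemma tail_lipschitz m n (A B : 'M[R]_(m, n)) lA sA uA vA lB sB uB vB k x y a b :
  svd A lA sA uA vA -> svd B lB sB uB vB -> 0 <= y < x -> 0 <= a -> 0 <= b ->
  `|sA k - x| <= a -> `|sA k.+1 - y| <= a -> `|sB k - x| <= b -> `|sB k.+1 - y| <= b ->
  a + b <= (x - y) / 2 ->
  frob (A - trunc sA uA vA k.+1 - (B - trunc sB uB vB k.+1))
  <= (1 + 2 * x / (x - y)) * frob (A - B).
Proof.
move=> hA hB /andP[y0 yx] a0 b0.
rewrite !ler_distl => /andP[A1 A2] /andP[A3 A4] /andP[B1 B2] /andP[B3 B4] ab.
have x_gt0 : 0 < x := le_lt_trans y0 yx.
(* Beyond the rank the singular value is 0, whereas a drift of at most half the gap keeps it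
   positive. *)
have kA : (k < lA)%N by rewrite ltnNge; apply/negP => /(svd_out hA); lra.
have kB : (k < lB)%N by rewrite ltnNge; apply/negP => /(svd_out hB); lra.
(* Chosen so that [(1 - w) * x] is the midpoint of [x] and [y], a level that separates the drifted
   singular values; [w^-1] becomes the Lipschitz constant of truncation. *)
pose w := (x - y) / (2 * x).
have w_gt0 : 0 < w by rewrite divr_gt0 ?mulr_gt0 ?subr_gt0.
have wx : w * x = (x - y) / 2 by rewrite /w; field; rewrite gt_eqF.
have w1 : w <= 1 by rewrite -(ler_pM2r x_gt0) wx; lra.
have wa : 0 <= w * a by rewrite mulr_ge0 // ltW.
have wb : 0 <= w * b by rewrite mulr_ge0 // ltW.
have w1' : 0 <= 1 - w by lra.
have hBA : sB k.+1 <= (1 - w) * sA k by have := ler_wpM2l w1' A1; lra.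
have hAB : sA k.+1 <= (1 - w) * sB k by have := ler_wpM2l w1' B1; lra.
have := trunc_lipschitz hA hB kA kB w1' hBA hAB.
have -> : 1 - (1 - w) = w by ring.
rewrite mulrC -ler_pdivlMr // => lip.
have -> : 2 * x / (x - y) = w^-1 by rewrite /w invf_div.
rewrite mulrDl mul1r (mulrC w^-1).
apply: le_trans (lerD (lexx _) lip); rewrite -[frob (trunc _ _ _ _ - _)]frobN.
apply: le_trans (frob_triangle _ _).
rewrite le_eqVlt; apply/orP; left; apply/eqP; congr frob.
move: (trunc sA _ _ _) (trunc sB _ _ _) => M N.
by apply/matrixP => i j; rewrite !mxE; ring.
Qed.

End TruncationIsLipschitz.

(** * Rank-one minimizers and error propagation through inexact deflation *)

Section Deflation.
Variable R : realType.

(** The factorization of [Y] through [X] makes a top singular component an admissible competitor.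
    Optimality then forces equality in the operator bound, so the normalized minimizer is itself a
    top pair and extends to a decomposition. *)
Lemma argmin_svd m d n (Y : 'M[R]_(m, n)) (W : 'M[R]_(m, d)) (X : 'M[R]_(d, n)) a b :
  Y = W *m X -> is_rank1_argmin Y X a b ->
  exists l s u v, svd Y l s u v /\ b *m a^T *m X = s 0%N *: (u 0%N *m (v 0%N)^T).
Proof.
move=> YW opt.
have {}opt (a' : 'cV[R]_d) (b' : 'cV[R]_m) : fdot (Y - b *m a^T *m X) (Y - b *m a^T *m X)
    <= fdot (Y - b' *m a'^T *m X) (Y - b' *m a'^T *m X).
  by have := opt a' b'; rewrite !sqr_frob; lra.
have [Y0|Yn0] := eqVneq Y 0.
  exists 0%N, (fun=> 0), (fun=> 0), (fun=> 0); split; first by rewrite Y0; exact: svd0.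
  rewrite scale0r; apply: fdot_eq0; apply/le_anti; rewrite fdot_ge0 andbT.
  have := opt 0 0; rewrite Y0 mul0mx mul0mx !sub0r !fdotNl !fdotNr !opprK.
  by rewrite fdot0r.
have [s0 [p [q hp]]] := top_pair_exists Yn0.
have [s0_gt0 p1 q1 Yq Yp Yop] := hp.
pose c := X^T *m a.
have BE : b *m a^T *m X = b *m c^T by rewrite /c trmx_mul trmxK mulmxA.
rewrite BE.
have expand (x : 'cV[R]_m) (y : 'cV[R]_n) : fdot (Y - x *m y^T) (Y - x *m y^T)
    = fdot Y Y - 2 * fdot x (Y *m y) + fdot x x * fdot y y.
  by rewrite !fdotB (fdotC Y) fdot_outer fdot_outer2; ring.
have le1 : fdot b b * fdot c c + s0 ^+ 2 <= 2 * fdot b (Y *m c).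
  have := opt (s0^-1 *: (W^T *m p)) (s0 *: p).
  have -> : s0 *: p *m (s0^-1 *: (W^T *m p))^T *m X = (s0 *: p) *m q^T.
    rewrite -mulmxA; congr (_ *m _); rewrite -[X in _ *m X]trmxK -trmx_mul.
    rewrite -scalemxAr mulmxA -trmx_mul -YW Yp scalerA mulVf ?scale1r //.
    by rewrite gt_eqF.
  rewrite BE !expand Yq !fdotZl !fdotZr p1 q1; lra.
have bc := fdot_op Yop b c.
have nb := frob_ge0 b; have nc := frob_ge0 c.
pose N := frob b * frob c.
have N0 : 0 <= N by exact: mulr_ge0.
have NN : fdot b b * fdot c c = N ^+ 2 by rewrite /N exprMn !sqr_frob.
(* [le1] and [bc] together say that the square of [N - s0] is at most 0. *)
have Ns : N = s0.
  apply/eqP; rewrite -subr_eq0 -sqrf_eq0; apply/eqP/le_anti; rewrite sqr_ge0 andbT.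
  rewrite NN -/N in le1 bc; rewrite sqrrB; lra.
have bn0 : frob b != 0 by apply: contraTneq s0_gt0 => b0; rewrite -Ns /N b0 mul0r ltxx.
have cn0 : frob c != 0 by apply: contraTneq s0_gt0 => c0; rewrite -Ns /N c0 mulr0 ltxx.
have b_gt0 : 0 < frob b by rewrite lt_neqAle eq_sym bn0.
have c_gt0 : 0 < frob c by rewrite lt_neqAle eq_sym cn0.
pose p' := (frob b)^-1 *: b; pose q' := (frob c)^-1 *: c.
have p'1 : fdot p' p' = 1 by rewrite fdotZl fdotZr -sqr_frob; field.
have q'1 : fdot q' q' = 1 by rewrite fdotZl fdotZr -sqr_frob; field.
have Ypq : fdot p' (Y *m q') = s0.
  have bYc : fdot b (Y *m c) = s0 ^+ 2.
    by rewrite NN -/N Ns in le1 bc; apply/le_anti; rewrite expr2 bc /=; lra.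
  by rewrite /p' /q' -scalemxAr fdotZl fdotZr bYc -Ns /N; field; rewrite bn0 cn0.
have BE' : b *m c^T = s0 *: (p' *m q'^T).
  have -> : q'^T = (frob c)^-1 *: c^T by rewrite /q' linearZ.
  rewrite /p' -scalemxAl -scalemxAr !scalerA -Ns /N.
  by rewrite (_ : _ * _ = 1) ?scale1r //; field; rewrite bn0 cn0.
clearbody p' q'.
(* Equality case: the squared norm of the difference is that of [Y *m q'] minus [s0 ^+ 2], which
   [Yop] makes nonpositive. *)
have Yq' : Y *m q' = s0 *: p'.
  apply/eqP; rewrite -subr_eq0; apply/eqP/fdot_eq0/le_anti; rewrite fdot_ge0 andbT.
  rewrite !fdotB !fdotZl !fdotZr (fdotC _ p') Ypq p'1 -sqr_frob.
  have := Yop q'; rewrite (frob_unit q'1) mulr1 => h.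
  have : frob (Y *m q') ^+ 2 <= s0 ^+ 2 by rewrite ler_sqr ?nnegrE ?frob_ge0 // ltW.
  lra.
have Yp' : Y^T *m p' = s0 *: q'.
  apply/eqP; rewrite -subr_eq0; apply/eqP/fdot_eq0/le_anti; rewrite fdot_ge0 andbT.
  rewrite !fdotB !fdotZl !fdotZr (fdotC q' (_ *m _)).
  rewrite (_ : fdot (Y^T *m p') q' = s0) ?q'1 -?sqr_frob -?fdot_mulmx //.
  have := op_bound_tr (ltW s0_gt0) Yop p'; rewrite (frob_unit p'1) mulr1 => h.
  have : frob (Y^T *m p') ^+ 2 <= s0 ^+ 2 by rewrite ler_sqr ?nnegrE ?frob_ge0 // ltW.
  lra.
have hp' : top_pair Y s0 p' q' by split.
have [l [s [u [v h]]]] := svd_exists (Y - s0 *: (p' *m q'^T)).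
exists l.+1, (scons s0 s), (scons p' u), (scons q' v).
by split => //; apply: svd_cons hp' h.
Qed.

Lemma sigma_max_ge0 p q (X : 'M[R]_(p, q)) : 0 <= sigma_max X.
Proof.
rewrite /sigma_max.
set S := (S in sup S).
(* A set without a supremum, such as the empty one arising when a dimension is 0, has [sup] equal to
   0 by convention. *)
have [[[x Sx] Sb]|nS] := boolp.pselect (has_sup S).
  by apply: le_trans (ub_le_sup Sb Sx); case: Sx.
by rewrite sup_out.
Qed.

(** [s] is itself a singular value, and [top_op] bounds all of them, so the supremum is a genuine
    one. *)
Lemma top_le_sigma_max p q (X : 'M[R]_(p, q)) s x y : top_pair X s x y -> s <= sigma_max X.
Proof.
case=> s_gt0 x1 y1 Xy Xx Xop; apply: ub_le_sup.
  exists s => t [t0 [u [v [u1 [v1 [Xv _]]]]]].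
  have toR k (w : 'cV[R]_k) : w^T *m w = 1%:M -> fdot w w = 1.
    by rewrite /fdot => ->; rewrite mxtrace1.
  have := Xop v; rewrite Xv frobZ // !frob_unit ?mulr1 //; exact: toR.
split; first exact: ltW.
by exists x, y; rewrite !scalar_dot x1 y1.
Qed.

(** Row by row: a transposed row of [D *m X] is [X^T] applied to a transposed row of [D]. *)
Lemma frob_mul_op p q k (D : 'M[R]_(k, p)) (X : 'M[R]_(p, q)) s :
  0 <= s -> op_bound X s -> frob (D *m X) <= s * frob D.
Proof.
move=> s0 Xs; rewrite -ler_sqr ?nnegrE ?mulr_ge0 ?frob_ge0 // exprMn !sqr_frob.
have rows l (M : 'M[R]_(k, l)) : fdot M M = \sum_i fdot (row i M)^T (row i M)^T.
  rewrite fdotE; apply: eq_bigr => i _; rewrite fdot_tr fdotE big_ord1.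
  by apply: eq_bigr => j _; rewrite !mxE.
rewrite !rows mulr_sumr; apply: ler_sum => i _.
rewrite row_mul trmx_mul -!sqr_frob -exprMn ler_sqr ?nnegrE ?mulr_ge0 ?frob_ge0 //.
exact: op_bound_tr.
Qed.

Lemma frob_mul_sigma_max p q k (D : 'M[R]_(k, p)) (X : 'M[R]_(p, q)) :
  frob (D *m X) <= sigma_max X * frob D.
Proof.
have [->|Xn0] := eqVneq X 0.
  by rewrite mulmx0 frob0 mulr_ge0 ?frob_ge0 ?sigma_max_ge0.
have [s [x [y h]]] := top_pair_exists Xn0.
apply: le_trans (frob_mul_op D (ltW (top_gt0 h)) (top_op h)) _.
by rewrite ler_wpM2r ?frob_ge0 // (top_le_sigma_max h).
Qed.

Lemma truncD m n s (u : nat -> 'cV[R]_m) (v : nat -> 'cV[R]_n) k j :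
  trunc s u v (k + j) = trunc s u v k
    + trunc (fun i => s (k + i)%N) (fun i => u (k + i)%N) (fun i => v (k + i)%N) j.
Proof. by rewrite /trunc big_split_ord. Qed.

(* Each step perturbs the exactly deflated matrix Z k - B k by eps k, and only the
   gap at the final rank matters for the Lipschitz constant of the remaining
   exact deflations; singular values drift additively, without amplification. *)
Lemma deflation_error m n (Z B : nat -> 'M[R]_(m, n)) (eps : nat -> R) r l s u v :
  svd (Z 0%N) l s u v -> s r.+1 < s r ->
  (forall k, (k <= r)%N -> exists l' s' u' v', svd (Z k) l' s' u' v'
     /\ B k = s' 0%N *: (u' 0%N *m (v' 0%N)^T)) ->
  (forall k, (k <= r)%N -> frob (Z k - B k - Z k.+1) <= eps k) ->
  (forall k, (k < r)%N ->
     \sum_(i < k) eps i + \sum_(i < k.+1) eps i <= (s r - s r.+1) / 2) ->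
  frob (Z r.+1 - (Z 0%N - trunc s u v r.+1))
  <= (1 + 2 * s r / (s r - s r.+1)) * \sum_(i < r) eps i + eps r.
Proof.
move=> h0 gap hB heps he; set C := 1 + _.
pose e k := \sum_(i < k) eps i.
have e0 k : (k <= r.+1)%N -> 0 <= e k.
  move=> kr; apply: sumr_ge0 => i _; apply: le_trans (frob_ge0 _) (heps i _).
  by rewrite -ltnS (leq_trans (ltn_ord i)).
have sr0 : 0 <= s r.+1 < s r by rewrite (svd_ge0 _ h0).
have C0 : 0 <= C.
  by rewrite addr_ge0 // divr_ge0 ?subr_ge0 ?mulr_ge0 ?(svd_ge0 _ h0) // ltW.
(* Invariant: the singular values of [Z k] follow those of [Z 0] shifted by [k], up to [e k], and
   the tails left after all [r.+1] removals differ by at most [C * e k]. *)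
have step k : (k <= r)%N -> exists l' s' u' v',
    [/\ svd (Z k) l' s' u' v', B k = s' 0%N *: (u' 0%N *m (v' 0%N)^T),
        forall i, `|s' i - s (k + i)%N| <= e k
      & frob (Z k - trunc s' u' v' (r - k).+1 - (Z 0%N - trunc s u v r.+1)) <= C * e k].
  elim: k => [|k IH] kr.
    have [l' [s' [u' [v' [h' B0]]]]] := hB 0%N kr.
    have e00 : e 0%N = 0 by rewrite /e big_ord0.
    have ss i : s' i = s i.
      have Z00 : frob (Z 0%N - Z 0%N) <= 0 by rewrite subrr frob0.
      have := weyl i h0 h' Z00; have := weyl i h' h0 Z00; lra.
    exists l', s', u', v'; split => //; first by move=> i; rewrite ss subrr normr0 e00.
    rewrite e00 mulr0 subn0.
    (* The decomposition supplied by [hB] may differ from the given one, but the gap makes both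
       truncations equal: this is the Lipschitz bound at distance 0. *)
    have := @tail_lipschitz _ _ _ _ _ _ _ _ _ _ _ _ _ r (s r) (s r.+1) 0 0 h' h0 sr0.
    rewrite !ss !subrr normr0 frob0 mulr0 addr0; apply => //.
    by rewrite divr_ge0 // subr_ge0 ltW.
  have [l1 [s1 [u1 [v1 [h1 B1 d1 t1]]]]] := IH (ltnW kr).
  have [l2 [s2 [u2 [v2 [h2 B2]]]]] := hB _ kr.
  have BT : trunc s1 u1 v1 1 = B k by rewrite /trunc big_ord1 B1.
  have h1' := svd_drop 1 h1; rewrite BT in h1'.
  have dk := heps k (ltnW kr).
  have eS : e k.+1 = e k + eps k by rewrite /e big_ord_recr.
  have d2 i : `|s2 i - s (k.+1 + i)%N| <= e k.+1.
    have := weyl i h1' h2 dk; have := weyl i h2 h1'; rewrite frob_distC => /(_ _ dk).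
    rewrite /= => w1 w2; have := d1 i.+1; rewrite addnS addSn !ler_distl eS.
    by rewrite add1n in w1 w2; case/andP => a1 a2; apply/andP; split; lra.
  exists l2, s2, u2, v2; split => //.
  have rk : (r - k = (r - k.+1).+1)%N by rewrite subnSK.
  have dr : (k + (r - k))%N = r by rewrite subnKC // ltnW.
  have dr' : (k.+1 + (r - k.+1))%N = r by rewrite subnKC.
  pose s1' i := s1 (1 + i)%N; pose u1' i := u1 (1 + i)%N; pose v1' i := v1 (1 + i)%N.
  (* Removing [B k] and then [r - k] further components of [Z k] amounts to removing its first
     [(r - k).+1], which links this bound to the induction hypothesis. *)
  have lip : frob (Z k - B k - trunc s1' u1' v1' (r - k) - (Z k.+1 - trunc s2 u2 v2 (r - k)))
      <= C * frob (Z k - B k - Z k.+1).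
    rewrite rk; apply: (tail_lipschitz h1' h2 sr0 (e0 k _) (e0 k.+1 _)).
    - exact: leq_trans (ltnW kr) (leqnSn r).
    - exact: leq_trans kr (leqnSn r).
    - by have := d1 (r - k)%N; rewrite dr add1n -rk.
    - by have := d1 (r - k).+1; rewrite addnS dr add1n -rk.
    - by have := d2 (r - k.+1)%N; rewrite dr'.
    - by have := d2 (r - k.+1).+1; rewrite addnS dr'.
    - exact: he.
  rewrite -rk eS mulrDr.
  have Zk : Z k - B k - trunc s1' u1' v1' (r - k) = Z k - trunc s1 u1 v1 (r - k).+1.
    by rewrite -[(r - k).+1]add1n truncD BT opprD addrA.
  rewrite Zk in lip.
  have {}lip := le_trans lip (ler_wpM2l C0 dk).
  apply: le_trans (frob_dist_triangle (Z k - trunc s1 u1 v1 (r - k).+1) _ _) _.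
  by rewrite addrC lerD // frob_distC.
(* At [k = r] the remaining truncation is [B r] alone, so the last perturbation enters without the
   factor [C]. *)
have [l' [s' [u' [v' [h' B' _ t']]]]] := step _ (leqnn r).
rewrite subnn /trunc big_ord1 -B' -/(trunc s u v r.+1) in t'.
apply: le_trans (frob_dist_triangle (Z r - B r) _ _) _.
by rewrite addrC lerD // frob_distC heps.
Qed.

End Deflation.

(** * Estimates for the products, sums and gaps in the bound *)

Section Constants.
Variable R : realType.

Lemma prod_ge1 (I : Type) (s : seq I) (P : pred I) (F : I -> R) :
  (forall i, P i -> 1 <= F i) -> 1 <= \prod_(i <- s | P i) F i.
Proof.
move=> F1; elim/big_rec: _ => // i x Pi x1.
by apply: le_trans (F1 i Pi) _; rewrite ler_peMr // (le_trans ler01) // F1.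
Qed.

Lemma prod_nat_ge1 a b (F : nat -> R) :
  (forall i, (a <= i < b)%N -> 1 <= F i) -> 1 <= \prod_(a <= i < b) F i.
Proof. by move=> F1; rewrite big_nat; apply: prod_ge1. Qed.

Lemma prod_nat_ge_last a b (F : nat -> R) : (a < b)%N ->
  (forall i, (a <= i < b)%N -> 1 <= F i) -> F b.-1 <= \prod_(a <= i < b) F i.
Proof.
case: b => // b ab F1; rewrite big_nat_recr //= ler_peMl //.
  by rewrite (le_trans ler01) // F1 // -ltnS ab ltnSn.
by apply: prod_nat_ge1 => i /andP[ai ib]; rewrite F1 // ai ltnW.
Qed.

(** The left side counts [e i] twice for [i < k] and once for [i = k]; [c i] is at least 2 except
    possibly at the last index, which is counted at most once. This turns the assumption on [E] into
    the drift condition of [deflation_error]. *)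
Lemma sum_consecutive_le p k (e c : nat -> R) : (k < p)%N ->
  (forall i, (i < p)%N -> 0 <= e i) -> (forall i, (i < p)%N -> 1 <= c i) ->
  (forall i, (i.+1 < p)%N -> 2 <= c i) ->
  \sum_(i < k) e i + \sum_(i < k.+1) e i <= \sum_(i < p) e i * c i.
Proof.
move=> kp e0 c1 c2.
rewrite (big_ord_widen p e (ltnW kp)) (big_ord_widen p e kp).
rewrite !(big_mkcond (fun i : 'I_p => (i < _)%N)) -big_split /=.
apply: ler_sum => i _; have ip := ltn_ord i; have ei := e0 _ ip.
have [ik|ki] := ltnP i k.
  have ci : 2 <= c i by apply: c2; lia.
  by rewrite ltnS (ltnW ik) -mulr2n -[e i *+ 2]mulr_natr ler_wpM2l.
have := ler_wpM2l ei (c1 _ ip); rewrite mulr1 add0r; case: ifP => // _ _.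
by rewrite mulr_ge0 // (le_trans ler01) // c1.
Qed.

Lemma Tstar_ge0 (sigma : nat -> R) rstar k : 0 <= sigma k -> 0 <= Tstar sigma rstar k.
Proof.
move=> s0; apply: (big_ind (fun x => 0 <= x)) => // x y x0 y0.
by rewrite le_min x0.
Qed.

Lemma Tstar_gt0 (sigma : nat -> R) rstar k : 0 < sigma k ->
  (forall j, (k < j <= rstar)%N -> 0 < `|sigma k - sigma j|) -> 0 < Tstar sigma rstar k.
Proof.
move=> s0 gap; rewrite /Tstar big_nat.
apply: (big_ind (fun x => 0 < x)) => // x y x0 y0.
by rewrite lt_min x0.
Qed.

Lemma Tstar_le_gap (sigma : nat -> R) rstar k : (k < rstar)%N ->
  Tstar sigma rstar k <= `|sigma k - sigma k.+1|.
Proof. by move=> kr; rewrite /Tstar big_ltn // ge_min lexx. Qed.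

End Constants.

(** * The inexact procedure applied to [Y] *)

Section Procedure.
Variables (R : realType) (d n m : nat).
Variables (X : 'M[R]_(d, n)) (Wstar : 'M[R]_(m, d)) (Y : 'M[R]_(m, n)).
Hypothesis hY : Y = Wstar *m X.
Variables (rstar : nat) (sigma : nat -> R) (u : nat -> 'cV[R]_m) (v : nat -> 'cV[R]_n).
Hypothesis hsvd : Y = \sum_(1 <= k < rstar.+1) sigma k *: (u k *m (v k)^T).
Hypothesis hu : forall i j, (1 <= i <= rstar)%N -> (1 <= j <= rstar)%N ->
  (u i)^T *m u j = (i == j)%:R%:M.
Hypothesis hv : forall i j, (1 <= i <= rstar)%N -> (1 <= j <= rstar)%N ->
  (v i)^T *m v j = (i == j)%:R%:M.
Hypothesis hdec : forall i j, (1 <= i)%N -> (i <= j)%N -> (j <= rstar)%N ->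
  sigma j <= sigma i.
Hypothesis hpos : 0 < sigma rstar.
Variables (r : nat) (a : nat -> 'cV[R]_d) (b : nat -> 'cV[R]_m).
Variables (abar : nat -> 'cV[R]_d) (bbar : nat -> 'cV[R]_m).
Hypothesis hmin : forall k, (1 <= k <= r)%N ->
  is_rank1_argmin (resid Y X a b k.-1) X (abar k) (bbar k).

Let err k := b k *m (a k)^T - bbar k *m (abar k)^T.
Let Ytop q := \sum_(1 <= k < q.+1) sigma k *: (u k *m (v k)^T).
(** Passage from indices starting at 1 to the convention of [svd], with values 0 beyond the rank. *)
Let s0 i := if (i < rstar)%N then sigma i.+1 else 0.
Let u0 i := u i.+1.
Let v0 i := v i.+1.

(** Supplies the factorization through [X] that [argmin_svd] requires at every step. *)
Lemma resid_range j : exists W, resid Y X a b j = W *m X.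
Proof.
elim: j => [|j [W eW]] /=; first by exists Wstar.
by exists (W - b j.+1 *m (a j.+1)^T); rewrite eW mulmxBl.
Qed.

Lemma residE j : resid Y X a b j = Y - \sum_(1 <= k < j.+1) b k *m (a k)^T *m X.
Proof.
elim: j => [|j IH]; first by rewrite big_geq ?subr0.
by rewrite [LHS]/= IH [in RHS]big_nat_recr //= opprD addrA.
Qed.

Lemma resid_step k : resid Y X a b k - bbar k.+1 *m (abar k.+1)^T *m X
  - resid Y X a b k.+1 = err k.+1 *m X.
Proof.
rewrite /err mulmxBl /=; move: (resid _ _ _ _ _) (_ *m X) (_ *m X) => M N P.
by apply/matrixP => i j; rewrite !mxE; ring.
Qed.

Lemma sigma_gt0 k : (1 <= k <= rstar)%N -> 0 < sigma k.
Proof. by case/andP=> k1 kr; apply: lt_le_trans hpos _; apply: hdec. Qed.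

Lemma YtopE q : (q <= rstar)%N -> Ytop q = trunc s0 u0 v0 q.
Proof.
move=> qr; rewrite /Ytop big_add1 big_mkord; apply: eq_bigr => i _.
by rewrite /s0 (leq_trans (ltn_ord i) qr).
Qed.

Lemma svdY : svd Y rstar s0 u0 v0.
Proof.
split.
- by rewrite {1}hsvd -/(Ytop rstar) YtopE.
- move=> i j ir jr; have := @hu i.+1 j.+1 ir jr; rewrite scalar_dot.
  by move/matrixP/(_ 0 0); rewrite !mxE /= eqSS.
- move=> i j ir jr; have := @hv i.+1 j.+1 ir jr; rewrite scalar_dot.
  by move/matrixP/(_ 0 0); rewrite !mxE /= eqSS.
- by move=> i ir; rewrite /s0 ir sigma_gt0.
- by move=> i ri; rewrite /s0 ltnNge ri.
- move=> i j ij; rewrite /s0; case: (ltnP j rstar) => jr.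
    by rewrite (leq_ltn_trans ij jr) hdec.
  by case: ifP => // ir; rewrite ltW // sigma_gt0.
Qed.

Let T := Tstar sigma rstar.
Let ndelta k := if k == 0%N then 0 else frob (err k).

Lemma ndelta_ge0 k : 0 <= ndelta k.
Proof. by rewrite /ndelta; case: ifP => // _; apply: frob_ge0. Qed.

Lemma ratio_ge0 j k : (1 <= j <= rstar)%N -> (1 <= k <= rstar)%N -> 0 <= 6 * sigma j / T k.
Proof.
move=> jr kr; rewrite divr_ge0 ?mulr_ge0 ?(ltW (sigma_gt0 jr)) //.
exact/Tstar_ge0/ltW/sigma_gt0.
Qed.

(** The [k]-th summand of the final bound, without [sigma_max X]. *)
Let F k := \sum_(0 <= k' < k.+1) ndelta k' * \prod_(k'.+1 <= j < k.+1) (2 + 6 * sigma j / T k).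

Lemma F_ge0 k : (1 <= k <= rstar)%N -> 0 <= F k.
Proof.
move=> kr; rewrite /F big_nat; apply: sumr_ge0 => k' kk'; rewrite mulr_ge0 ?ndelta_ge0 //.
rewrite (le_trans ler01) //; apply: prod_nat_ge1 => j jk.
have : 0 <= 6 * sigma j / T k by apply: ratio_ge0; lia.
lra.
Qed.

Lemma ndelta_le_F k : (1 <= k <= rstar)%N -> ndelta k <= F k.
Proof.
move=> kr; rewrite /F big_nat_recr //= [X in _ * X]big_geq // mulr1 lerDr.
rewrite big_nat; apply: sumr_ge0 => k' kk'; rewrite mulr_ge0 ?ndelta_ge0 //.
rewrite (le_trans ler01) //; apply: prod_nat_ge1 => j jk.
have : 0 <= 6 * sigma j / T k by apply: ratio_ge0; lia.
lra.
Qed.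

(** [deflation_error] with last index [q.-1], after which its constant is absorbed into a single
    factor of each product in [F q]. *)
Lemma residual_error q : (1 <= q <= r)%N -> (q < rstar)%N ->
  (forall j, (q < j <= rstar)%N ->
     sigma_max X * \sum_(0 <= k' < q) ndelta k' *
       \prod_(k'.+1 <= j < q) (6 * sigma j / T j + 2) < `|sigma q - sigma j| / 2) ->
  frob (resid Y X a b q - (Y - Ytop q)) <= sigma_max X * F q.
Proof.
case: q => // p /andP[_ pr] prs hE; rewrite YtopE; last exact: ltnW.
have smax := sigma_max_ge0 X.
set E := sigma_max X * _ in hE.
pose eps i := sigma_max X * ndelta i.+1.
have eps0 i : 0 <= eps i by rewrite mulr_ge0 ?ndelta_ge0.
pose c i := \prod_(i.+2 <= j < p.+1) (6 * sigma j / T j + 2).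
(* The term [k' = 0] vanishes, and the index drops by one to match [eps]. *)
have cE : E = \sum_(i < p) eps i * c i.
  rewrite /E big_nat_recl //= /ndelta /= mul0r add0r big_mkord mulr_sumr.
  by apply: eq_bigr => i _; rewrite mulrA.
have fac j : (1 < j <= p)%N -> 2 <= 6 * sigma j / T j + 2.
  move=> jp; have : 0 <= 6 * sigma j / T j by apply: ratio_ge0; lia.
  lra.
have c1 i : (i < p)%N -> 1 <= c i.
  by move=> ip; apply: prod_nat_ge1 => j ij; apply: le_trans (fac j _); [lra|lia].
have c2 i : (i.+1 < p)%N -> 2 <= c i.
  move=> ip; apply: le_trans (fac p _) _; first by lia.
  apply: (@prod_nat_ge_last R i.+2 p.+1 (fun j => 6 * sigma j / T j + 2)) => [|j ij].
    by lia.
  by apply: le_trans (fac j _); [lra|lia].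
have E0 : 0 <= E by rewrite cE; apply: sumr_ge0 => i _; rewrite mulr_ge0 // (le_trans ler01) // c1.
have gapE : E < `|sigma p.+1 - sigma p.+2| / 2 by apply: hE; lia.
have sle : sigma p.+2 <= sigma p.+1 by apply: hdec; lia.
rewrite ger0_norm ?subr_ge0 // in gapE.
have sp : s0 p = sigma p.+1 by rewrite /s0 ltnW.
have sp1 : s0 p.+1 = sigma p.+2 by rewrite /s0 prs.
pose B k := bbar k.+1 *m (abar k.+1)^T *m X.
have := @deflation_error R m n (resid Y X a b) B eps p rstar s0 u0 v0 svdY.
rewrite sp sp1 => /(_ _ _ _ _) h.
apply: le_trans (h _ _ _ _) _.
- lra.
- move=> k kp; have [W YW] := resid_range k.
  by apply: argmin_svd YW _; apply: (@hmin k.+1); lia.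
- by move=> k kp; rewrite resid_step; apply: frob_mul_sigma_max.
- move=> k kp; apply: le_trans (sum_consecutive_le kp _ c1 c2) _ => //.
  by rewrite -cE ltW.
(* Each gap exceeds [2 * E] and [E] is nonnegative, so the denominators are genuine. *)
have T_gt0 : 0 < T p.+1.
  apply: Tstar_gt0; first by apply: sigma_gt0; lia.
  by move=> j /hE; lra.
have T_le : T p.+1 <= sigma p.+1 - sigma p.+2.
  by have := Tstar_le_gap sigma prs; rewrite ger0_norm // subr_ge0.
(* The right side is the factor [j = p.+1], the last one in every nonempty product of [F p.+1]. *)
have Cle : 1 + 2 * sigma p.+1 / (sigma p.+1 - sigma p.+2) <= 2 + 6 * sigma p.+1 / T p.+1.
  apply: lerD; first by lra.
  have sp_gt0 : 0 < sigma p.+1 by apply: sigma_gt0; lia.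
  apply: ler_pM; rewrite ?invr_ge0 ?mulr_ge0 ?(ltW sp_gt0) //; first by lra.
    by lra.
  by rewrite lef_pV2 ?posrE //; lra.
rewrite /F big_nat_recl //= {1}/ndelta /= mul0r add0r big_mkord big_ord_recr /=.
rewrite (@big_geq _ _ _ p.+2 p.+2) // mulr1 mulrDr lerD2r !mulr_sumr.
apply: ler_sum => i _; rewrite /eps [leLHS]mulrCA; apply: ler_wpM2l => //.
rewrite [leLHS]mulrC; apply: ler_wpM2l; first exact: ndelta_ge0.
apply: le_trans Cle _.
apply: (@prod_nat_ge_last R i.+2 p.+2 (fun j => 2 + 6 * sigma j / T p.+1)) => [|j ij].
  by have := ltn_ord i; lia.
have : 0 <= 6 * sigma j / T p.+1 by apply: ratio_ge0; lia.
lra.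
Qed.

Lemma frob_Ytop_diff q q' : (q <= q' <= rstar)%N ->
  frob (Ytop q' - Ytop q) <= \sum_(q.+1 <= k < q'.+1) sigma k.
Proof.
move=> /andP[qq' q'r]; rewrite /Ytop (@big_cat_nat _ _ _ q.+1 1 q'.+1) //= addrAC subrr add0r.
apply: le_trans (frob_sum _ _ _) _; rewrite [leLHS]big_nat [leRHS]big_nat; apply: ler_sum => k kq.
have k1 : (1 <= k <= rstar)%N by lia.
rewrite frobZ; last exact/ltW/sigma_gt0.
rewrite frob_unit ?mulr1 // fdot_outer2.
have -> : fdot (u k) (u k) = 1 by rewrite /fdot hu // eqxx mxtrace1.
by rewrite /fdot hv // eqxx mxtrace1 mulr1.
Qed.

(** Without a gap after the last index, optimality of the exact minimizer is used instead: it does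
    at least as well as the last singular component of [Y], which is [Y - Ytop r.-1]. *)
Lemma last_residual_error : (1 <= r)%N -> r = rstar ->
  frob (resid Y X a b r) <= frob (resid Y X a b r.-1 - (Y - Ytop r.-1)) + sigma_max X * ndelta r.
Proof.
case: r hmin => // p hmin' _ prs /=.
set B := bbar p.+1 *m (abar p.+1)^T *m X.
have := resid_step p; set Z := resid Y X a b p => stepE.
have -> : Z - b p.+1 *m (a p.+1)^T *m X = (Z - B) - err p.+1 *m X by rewrite -stepE opprB subrKC.
apply: le_trans (frob_triangle _ _) _; rewrite frobN; apply: lerD; last exact: frob_mul_sigma_max.
have pr : (p < rstar)%N by rewrite -prs.
have /gt_eqF sn0 : 0 < sigma p.+1 by apply: sigma_gt0; rewrite -prs leqnn.
have -> : Y - Ytop p = sigma p.+1 *: (u p.+1 *m (v p.+1)^T).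
  by rewrite hsvd -prs big_nat_recr //= addrAC subrr add0r.
(* The competitor realizes that component as a product ending in [X], through [Y = Wstar *m X]. *)
have := hmin' p.+1; rewrite leqnn => /(_ isT) /(_ ((sigma p.+1)^-1 *: (Wstar^T *m u p.+1)) (sigma p.+1 *: u p.+1)).
have -> : sigma p.+1 *: u p.+1 *m ((sigma p.+1)^-1 *: (Wstar^T *m u p.+1))^T *m X
          = sigma p.+1 *: (u p.+1 *m (v p.+1)^T).
  rewrite -mulmxA -scalemxAl; congr (_ *: (_ *m _)).
  rewrite -[X in _ *m X]trmxK -trmx_mul -scalemxAr mulmxA -trmx_mul -hY.
  have := svd_left (svd_tr svdY) pr; rewrite /u0 /v0 /s0 pr => ->.
  by rewrite scalerA mulVf ?scale1r // sn0.
rewrite -/Z -/B => h; rewrite -ler_sqr ?nnegrE ?frob_ge0 //; lra.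
Qed.

End Procedure.

Theorem theorem4 (R : realType) (d n m : nat)
  (X : 'M[R]_(d, n)) (Wstar : 'M[R]_(m, d)) (Y : 'M[R]_(m, n))
  (hY : Y = Wstar *m X)
  (* SVD of Y, indices 1..rstar *)
  (rstar : nat) (sigma : nat -> R) (u : nat -> 'cV[R]_m) (v : nat -> 'cV[R]_n)
  (hrank : rstar = \rank Y)
  (hsvd : Y = \sum_(1 <= k < rstar.+1) sigma k *: (u k *m (v k)^T))
  (hu : forall i j, (1 <= i <= rstar)%N -> (1 <= j <= rstar)%N ->
          (u i)^T *m u j = (i == j)%:R%:M)
  (hv : forall i j, (1 <= i <= rstar)%N -> (1 <= j <= rstar)%N ->
          (v i)^T *m v j = (i == j)%:R%:M)
  (hdec : forall i j, (1 <= i)%N -> (i <= j)%N -> (j <= rstar)%N -> sigma j <= sigma i)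
  (hpos : 0 < sigma rstar)
  (* target rank and procedure output *)
  (r : nat) (hr : (1 <= r <= rstar)%N)
  (a : nat -> 'cV[R]_d) (b : nat -> 'cV[R]_m)
  (* exact minimizers at each step, defining the numerical errors *)
  (abar : nat -> 'cV[R]_d) (bbar : nat -> 'cV[R]_m)
  (hmin : forall k, (1 <= k <= r)%N ->
          is_rank1_argmin (resid Y X a b k.-1) X (abar k) (bbar k))
  (hdelta : forall k, (1 <= k <= r)%N ->
          0 < frob (b k *m (a k)^T - bbar k *m (abar k)^T)) :
  let ndelta := fun k : nat =>
    if k == 0%N then 0 else frob (b k *m (a k)^T - bbar k *m (abar k)^T) in
  let E := fun k : nat =>
    sigma_max X * \sum_(0 <= k' < k) ndelta k' *
      \prod_(k'.+1 <= j < k) (6 * sigma j / Tstar sigma rstar j + 2) in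
  (forall k, (1 <= k <= r)%N ->
     forall j, (k < j <= rstar)%N -> E k < `|sigma k - sigma j| / 2) ->
  forall r', (r <= r' <= rstar)%N ->
    frob (\sum_(1 <= k < r'.+1) sigma k *: (u k *m (v k)^T)
          - \sum_(1 <= k < r.+1) b k *m (a k)^T *m X)
    <= \sum_(r.+1 <= k < r'.+1) sigma k
       + sigma_max X * \sum_(1 <= k < r.+1) \sum_(0 <= k' < k.+1) ndelta k' *
           \prod_(k'.+1 <= j < k.+1) (2 + 6 * sigma j / Tstar sigma rstar k).
Proof.
move=> ndelta E hE r' hr'.
pose Ytop q := \sum_(1 <= k < q.+1) sigma k *: (u k *m (v k)^T).
pose F k := \sum_(0 <= k' < k.+1) ndelta k' *
  \prod_(k'.+1 <= j < k.+1) (2 + 6 * sigma j / Tstar sigma rstar k).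
have smax := sigma_max_ge0 X.
have F0 k : (1 <= k <= rstar)%N -> 0 <= F k by exact: F_ge0.
have core q : (1 <= q <= r)%N -> (q < rstar)%N ->
    frob (resid Y X a b q - (Y - Ytop q)) <= sigma_max X * F q.
  by move=> qr qs; apply: (residual_error hY hsvd hu hv hdec hpos hmin) => // j jq; apply: hE.
(* The error splits into the components of [Y] between [r] and [r'] and the deviation of the
   residual from the exact tail. *)
have -> : Ytop r' - \sum_(1 <= k < r.+1) b k *m (a k)^T *m X
    = (Ytop r' - Ytop r) + (resid Y X a b r - (Y - Ytop r)).
  rewrite residE; move: (\sum_(1 <= k < r.+1) _) => M.
  by apply/matrixP => i j; rewrite !mxE; ring.
apply: le_trans (frob_triangle _ _) _.
apply: lerD; first exact: (frob_Ytop_diff hu hv).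
case/andP: hr => r1 rle.
have sum0 q : (q <= r)%N -> 0 <= \sum_(1 <= k < q.+1) F k.
  by move=> qr; rewrite big_nat; apply: sumr_ge0 => k kq; apply: F0; lia.
have [rs|rs] := ltnP r rstar.
  apply: le_trans (core r _ rs) _; first by rewrite r1 leqnn.
  (* The summand [F r] alone suffices; the others are nonnegative. *)
  rewrite ler_wpM2l // -/(F _) big_nat_recr //= lerDr.
  by have := sum0 r.-1 (leq_pred r); rewrite prednK.
have {rs rle} rE : r = rstar by apply/eqP; rewrite eqn_leq rle.
have -> : Y - Ytop r = 0 by rewrite /Ytop rE -hsvd subrr.
rewrite subr0; apply: le_trans (last_residual_error hY hsvd hu hv hdec hpos hmin r1 rE) _.
(* [F r] absorbs the last perturbation and the earlier summands the error after [r.-1] steps. *)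
rewrite [in leRHS]big_nat_recr //= mulrDr; apply: lerD; last first.
  by rewrite ler_wpM2l //; apply: ndelta_le_F; rewrite // -rE r1 leqnn.
(* For [r = 1] the earlier residual is [Y] itself and its error is 0; otherwise [core] applies at
   [r.-1 < rstar]. *)
case: r r1 rE core sum0 {hE hmin hdelta hr'} => // -[|p] _ rE core sum0 /=.
  by rewrite /Ytop [\sum_(1 <= k < 1) _]big_geq // subr0 subrr frob0 big_geq ?mulr0.
apply: le_trans (core p.+1 _ _) _; [lia|by rewrite -rE|].
rewrite ler_wpM2l // big_nat_recr //= lerDr.
by apply: sum0; lia.
Qed.
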